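(* Let $(M,g,\kappa)$ be a weak Carrollian manifold. (1) There exists a Carrollian connection on $(M,g,\kappa)$; that is, $(M,g,\kappa)$ can be made into a strong Carrollian manifold. (2) There exists a Carrollian connection $\nabla$ on $(M,g,\kappa)$ for which $\kappa$ is parallel, i.e., $\nabla_X\kappa=0$ for all $X\in\mathrm{Vect}(M)$. (3) There exists a Carrollian connection on $(M,g,\kappa)$ with vanishing torsion if and only if $g$ is stationary, i.e., $\mathcal{L}_Y g=0$ for every vector field $Y\in\ker(g)$.
   Context: Manifolds are finite-dimensional, second-countable, Hausdorff and smooth; $\mathrm{Vect}(M)$ is the space of smooth vector fields. A weak Carrollian manifold is a triple $(M,g,\kappa)$ where $M$ is a smooth manifold, $g$ is a smooth degenerate metric (symmetric $(0,2)$-tensor field) whose pointwise diagonalisation is $\mathrm{diag}(1,1,\dots,1,0)$, and $\kappa$ is a nowhere vanishing complete vector field such that $\ker(g)=\mathrm{Span}\{\kappa\}$ (where $\ker(g)$ is the set of vector fields $Y$ with $g(Y,X)=0$ for all $X\in\mathrm{Vect}(M)$, i.e., the $C^\infty(M)$-multiples of $\kappa$). A Carrollian connection on $(M,g,\kappa)$ is an affine connection $\nabla$ on $M$ such that $\nabla_XY\in\ker(g)$ for all $X\in\mathrm{Vect}(M)$, $Y\in\ker(g)$, and $X(g(Y,Z))=g(\nabla_XY,Z)+g(Y,\nabla_XZ)$ for all $X,Y,Z\in\mathrm{Vect}(M)$. No torsion-free condition is imposed. A strong Carrollian manifold is a weak Carrollian manifold equipped with a Carrollian connection. The torsion is $T(X,Y)=\nabla_XY-\nabla_YX-[X,Y]$.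 *)

(* Defs.v *)
From HB Require Import structures.
From mathcomp Require Import all_boot all_order all_algebra.
From mathcomp Require Import all_classical all_reals all_analysis.
From mathcomp Require Import ring.
Set Implicit Arguments.
Unset Strict Implicit.
Unset Printing Implicit Defensive.
Import Order.TTheory GRing.Theory Num.Theory.
Import numFieldNormedType.Exports.
Local Open Scope classical_set_scope.
Local Open Scope ring_scope.

Lemma near_eq_differentiable (R : realType) (V W : normedModType R)
    (f g : V -> W) (x : V) :
  (\near x, f x = g x) -> differentiable f x -> differentiable g x.
Proof.
move=> fg /diff_locallyP[cf fE].
have gE : g \o shift x = cst (g x) + 'd f x +o_ 0 id.
  apply/eqaddoP => e e0.
  have := fE => /eqaddoP /(_ e e0).
  have fg0 : \forall y \near 0, f (y + x) = g (y + x).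
    by move: fg; rewrite (near_shift 0) /= subr0.
  apply: filterS2 fg0 => y fgy.
  by rewrite !fctE /= fgy (nbhs_singleton fg).
by apply/diff_locallyP; rewrite (diff_unique cf gE).
Qed.

Section smooth_real_functions.
Context {R : realType} {n : nat}.
Implicit Types (U : set 'rV[R]_n) (f g : 'rV[R]_n -> R).

(* Meaningful for [U] open only, as all the notions involved are local. *)
Fixpoint Ck (k : nat) U f : Prop :=
  match k with
  | 0 => forall x, U x -> {for x, continuous f}
  | k'.+1 => (forall x, U x -> differentiable f x) /\
             (forall v, Ck k' U ('D_v f))
  end.

Definition smooth_on U f : Prop := forall k, Ck k U f.

Let near_eq_open U f g x : open U -> (forall x, U x -> f x = g x) -> U x ->
  \near x, f x = g x.
Proof.
move=> oU fg Ux.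
by apply: filterS (open_nbhs_nbhs (conj oU Ux)) => y /fg.
Qed.

Lemma Ck_ext k U f g : open U -> (forall x, U x -> f x = g x) ->
  Ck k U f -> Ck k U g.
Proof.
move=> oU; elim: k f g => [|k IH] f g fg /=.
  move=> fc x Ux; have fgx := near_eq_open oU fg Ux.
  rewrite /prop_for /continuous_at -(fg x Ux).
  exact: cvg_trans (near_eq_cvg fgx) (fc x Ux).
move=> [fd fD]; split=> [x Ux|v].
  exact: near_eq_differentiable (near_eq_open oU fg Ux) (fd x Ux).
apply: IH (fD v) => x Ux; exact: near_eq_derive (near_eq_open oU fg Ux).
Qed.

Lemma CkS k U f : Ck k.+1 U f -> Ck k U f.
Proof.
elim: k f => [|k IH] f [fd fD].
  by move=> x /fd; exact: differentiable_continuous.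
by split=> // v; exact: IH.
Qed.

Lemma Ck_cst k U (a : R) : Ck k U (cst a).
Proof.
elim: k a => [|k IH] a /=; first by move=> x _; exact: cst_continuous.
split=> [x _|v]; first exact: differentiable_cst.
have -> : 'D_v (cst a : 'rV[R]_n -> R) = cst 0.
  by apply/funext => x; rewrite derive_cst.
exact: IH.
Qed.

Lemma CkB k U f g : open U -> Ck k U f -> Ck k U g -> Ck k U (f - g).
Proof.
move=> oU; elim: k f g => [|k IH] f g /=.
  by move=> fc gc x Ux; apply: continuousB; [exact: fc|exact: gc].
move=> [fd fD] [gd gD]; split=> [x Ux|v].
  by apply: differentiableB; [exact: fd|exact: gd].
apply: (Ck_ext oU _ (IH _ _ (fD v) (gD v))) => x Ux.
by rewrite deriveB; [|exact/diff_derivable/fd|exact/diff_derivable/gd].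
Qed.

Lemma CkM k U f g : open U -> Ck k U f -> Ck k U g -> Ck k U (f * g).
Proof.
move=> oU; elim: k f g => [|k IH] f g.
  by move=> fc gc x Ux; apply: continuousM; [exact: fc|exact: gc].
move=> fk gk; move: (fk) (gk) => [fd fD] [gd gD]; split=> [x Ux|v].
  by apply: differentiableM; [exact: fd|exact: gd].
have hD : Ck k U (f * 'D_v g - (- (g * 'D_v f))).
  apply: CkB => //; first exact: IH (CkS fk) (gD v).
  rewrite -sub0r; apply: CkB => //; first exact: Ck_cst.
  exact: IH (CkS gk) (fD v).
apply: (Ck_ext oU _ hD) => x Ux.
rewrite deriveM; [|exact/diff_derivable/fd|exact/diff_derivable/gd].
by rewrite opprK.
Qed.

End smooth_real_functions.

(* Homeomorphism from an open set of [M] to an open set of R^n; outside of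
   [chart_dom] and [chart_cod], the functions take irrelevant values. *)
Record chart (R : realType) (n : nat) (M : topologicalType) := Chart {
  chart_dom : set M ;
  chart_cod : set 'rV[R]_n ;
  chart_map :> M -> 'rV[R]_n ;
  chart_inv : 'rV[R]_n -> M ;
  chart_dom_open : open chart_dom ;
  chart_cod_open : open chart_cod ;
  chart_map_fun : set_fun chart_dom chart_cod chart_map ;
  chart_inv_fun : set_fun chart_cod chart_dom chart_inv ;
  chart_mapK : {in chart_dom, cancel chart_map chart_inv} ;
  chart_invK : {in chart_cod, cancel chart_inv chart_map} ;
  chart_map_continuous : {within chart_dom, continuous chart_map} ;
  chart_inv_continuous : {within chart_cod, continuous chart_inv} }.

Arguments chart_dom_open {R n M} c.
Arguments chart_cod_open {R n M} c.

(* The atlas need not be maximal: a maximal atlas is determined by any atlas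
   it contains, and so are the smooth functions below. *)
Record manifold (R : realType) (n : nat) := Manifold {
  manifold_sort :> topologicalType ;
  manifold_hausdorff : hausdorff_space manifold_sort ;
  manifold_second_countable : @second_countable manifold_sort ;
  atlas : set (chart R n manifold_sort) ;
  atlas_cover : forall p, exists2 c, atlas c & chart_dom c p ;
  atlas_compatible : forall c c', atlas c -> atlas c' -> forall j : 'I_n,
    smooth_on (chart_cod c `&` chart_inv c @^-1` chart_dom c')
              (fun x => c' (chart_inv c x) 0 j) }.

Arguments atlas {R n} _ _.

Section smooth_functions.
Context {R : realType} {n : nat} (M : manifold R n).

Definition smooth : {pred M -> R} := fun f =>
  `[< forall c, atlas M c -> smooth_on (chart_cod c) (f \o chart_inv c) >].

Fact smooth_subring : subring_closed smooth.
Proof.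
split=> [|f g /asboolP fs /asboolP gs|f g /asboolP fs /asboolP gs].
- by apply/asboolP => c _ k; exact: Ck_cst.
- apply/asboolP => c cM k.
  by have := CkB (chart_cod_open c) (fs c cM k) (gs c cM k).
- apply/asboolP => c cM k.
  by have := CkM (chart_cod_open c) (fs c cM k) (gs c cM k).
Qed.

Fact smooth_scaler : scaler_closed smooth.
Proof.
have [_ _ sM] := smooth_subring.
move=> a f fs; have -> : a *: f = cst a * f by [].
by apply: sM => //; apply/asboolP => c _ k; exact: Ck_cst.
Qed.

HB.instance Definition _ := GRing.isSubringClosed.Build (M -> R) smooth
  smooth_subring.
HB.instance Definition _ := GRing.isScaleClosed.Build R (M -> R) smooth
  smooth_scaler.

Record Cinf := MkCinf { Cinf_fun :> M -> R ; Cinf_smooth : Cinf_fun \in smooth }.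

HB.instance Definition _ := [isSub for Cinf_fun].
HB.instance Definition _ := [Choice of Cinf by <:].
HB.instance Definition _ := GRing.SubChoice_isSubComPzRing.Build _ _ Cinf (GRing.subringClosedP smooth).
HB.instance Definition _ := [SubZmodule_isSubLmodule of Cinf by <:].

End smooth_functions.

Arguments smooth {R n} M _.

(* Tangent vectors at [p] are the R-linear maps on the algebra of smooth
   functions that satisfy the Leibniz rule at [p], and vector fields are the
   families of tangent vectors that map smooth functions to smooth ones. *)
Section tangent_vectors.
Context {R : realType} {n : nat} (M : manifold R n).

Definition derivation_at (p : M) : {pred Cinf M -> R} := fun v =>
  `[< scalar v /\ forall f g : Cinf M, v (f * g) = f p * v g + v f * g p >].

Fact derivation_at_submod p : submod_closed (derivation_at p).
Proof.
split=> [|a u v /asboolP[uL uM] /asboolP[vL vM]]; apply/asboolP; split.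
- by move=> b f g; change (0 = b * 0 + 0 :> R); rewrite mulr0 addr0.
- by move=> f g; change (0 = f p * 0 + 0 * g p); rewrite mulr0 mul0r addr0.
- move=> b f g.
  change (a * u (b *: f + g) + v (b *: f + g) =
          b * (a * u f + v f) + (a * u g + v g)).
  by rewrite uL vL; ring.
- move=> f g.
  change (a * u (f * g) + v (f * g) =
          f p * (a * u g + v g) + (a * u f + v f) * g p).
  by rewrite uM vM; ring.
Qed.

HB.instance Definition _ (p : M) := GRing.isSubmodClosed.Build R (Cinf M -> R)
  (derivation_at p) (GRing.submod_closed_semi (derivation_at_submod p)).

Record tangent (p : M) := Tangent {
  tangent_fun :> Cinf M -> R ;
  tangentP : tangent_fun \in derivation_at p }.

HB.instance Definition _ (p : M) := [isSub for @tangent_fun p].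
HB.instance Definition _ (p : M) := [Choice of tangent p by <:].
HB.instance Definition _ (p : M) := [SubChoice_isSubLmodule of tangent p by <:].

Definition is_basis (p : M) (m : nat) (e : 'I_m -> tangent p) : Prop :=
  forall v : tangent p, exists! a : 'rV[R]_m, v = \sum_i a 0 i *: e i.

Record Vect := MkVect {
  Vect_at :> forall p, tangent p ;
  Vect_smooth : forall f : Cinf M, (fun p => Vect_at p f) \in smooth M }.

Definition Vact (X : Vect) (f : Cinf M) : Cinf M := MkCinf (Vect_smooth X f).

Lemma Vect_ext (X Y : Vect) : (forall p, X p = Y p) -> X = Y.
Proof.
case: X Y => [X Xs] [Y Ys] /= XY.
have eXY : X = Y by apply: functional_extensionality_dep.
by subst Y; congr MkVect; exact: Prop_irrelevance.
Qed.

HB.instance Definition _ := gen_eqMixin Vect.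
HB.instance Definition _ := gen_choiceMixin Vect.

Fact Vzero_smooth (f : Cinf M) :
  (fun p : M => (0 : tangent p) f) \in smooth M.
Proof. exact: (Cinf_smooth 0). Qed.

Fact Vadd_smooth (X Y : Vect) (f : Cinf M) :
  (fun p => (X p + Y p) f) \in smooth M.
Proof. exact: (Cinf_smooth (Vact X f + Vact Y f)). Qed.

Fact Vopp_smooth (X : Vect) (f : Cinf M) : (fun p => (- X p) f) \in smooth M.
Proof. exact: (Cinf_smooth (- Vact X f)). Qed.

Fact Vscale_smooth (h : Cinf M) (X : Vect) (f : Cinf M) :
  (fun p => (h p *: X p) f) \in smooth M.
Proof. exact: (Cinf_smooth (h * Vact X f)). Qed.

Definition Vzero := MkVect Vzero_smooth.
Definition Vadd (X Y : Vect) := MkVect (Vadd_smooth X Y).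
Definition Vopp (X : Vect) := MkVect (Vopp_smooth X).
Definition Vscale (h : Cinf M) (X : Vect) := MkVect (Vscale_smooth h X).

Fact VaddA : associative Vadd.
Proof. by move=> X Y Z; apply: Vect_ext => p; exact: addrA. Qed.
Fact VaddC : commutative Vadd.
Proof. by move=> X Y; apply: Vect_ext => p; exact: addrC. Qed.
Fact Vadd0 : left_id Vzero Vadd.
Proof. by move=> X; apply: Vect_ext => p; exact: add0r. Qed.
Fact VaddN : left_inverse Vzero Vopp Vadd.
Proof. by move=> X; apply: Vect_ext => p; exact: addNr. Qed.

HB.instance Definition _ := GRing.isZmodule.Build Vect VaddA VaddC Vadd0 VaddN.

Fact VscaleA f g (X : Vect) : Vscale f (Vscale g X) = Vscale (f * g) X.
Proof. by apply: Vect_ext => p; exact: scalerA. Qed.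
Fact Vscale1 : left_id 1 Vscale.
Proof. by move=> X; apply: Vect_ext => p; exact: scale1r. Qed.
Fact VscaleDr : right_distributive Vscale +%R.
Proof. by move=> f X Y; apply: Vect_ext => p; exact: scalerDr. Qed.
Fact VscaleDl (X : Vect) : {morph Vscale^~ X : f g / f + g}.
Proof. by move=> f g; apply: Vect_ext => p; exact: scalerDl. Qed.

HB.instance Definition _ := GRing.Zmodule_isLmodule.Build (Cinf M) Vect
  VscaleA Vscale1 VscaleDr VscaleDl.

Definition bracket_at (X Y : Vect) (p : M) (f : Cinf M) : R :=
  X p (Vact Y f) - Y p (Vact X f).

Fact tangentL p (v : tangent p) a f g : v (a *: f + g) = a * v f + v g.
Proof. by have /asboolP[+ _] := tangentP v; apply. Qed.

Fact tangentM p (v : tangent p) f g : v (f * g) = f p * v g + v f * g p.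
Proof. by have /asboolP[_ +] := tangentP v; apply. Qed.

Fact tangentD p (v : tangent p) f g : v (f + g) = v f + v g.
Proof. by rewrite -[f]scale1r tangentL mul1r scale1r. Qed.

Fact bracket_derivation X Y p : bracket_at X Y p \in derivation_at p.
Proof.
have L (Z : Vect) a f g : Vact Z (a *: f + g) = a *: Vact Z f + Vact Z g.
  by apply/val_inj/funext => q; exact: tangentL.
have P (Z : Vect) f g : Vact Z (f * g) = f * Vact Z g + Vact Z f * g.
  by apply/val_inj/funext => q; exact: tangentM.
apply/asboolP; split=> [a f g|f g]; rewrite /bracket_at.
  by rewrite !L !tangentL /GRing.scale /=; ring.
rewrite !P !tangentD !tangentM /=; ring.
Qed.

Fact bracket_smooth X Y (f : Cinf M) :
  (fun p => Tangent (bracket_derivation X Y p) f) \in smooth M.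
Proof. exact: (Cinf_smooth (Vact X (Vact Y f) - Vact Y (Vact X f))). Qed.

Definition bracket (X Y : Vect) : Vect := MkVect (bracket_smooth X Y).

(* Completeness of the flow; testing the velocity [c' t] against all smooth
   functions is the equality [c' t = X (c t)] of tangent vectors. *)
Definition complete_field (X : Vect) : Prop := forall p : M,
  exists c : R -> M, [/\ c 0 = p, continuous c &
    forall (t : R) (f : Cinf M), is_derive t 1 (f \o c) (X (c t) f)].

Record connection := Connection {
  connection_fun :> Vect -> Vect -> Vect ;
  connectionDl : forall X X' Y,
    connection_fun (X + X') Y = connection_fun X Y + connection_fun X' Y ;
  connectionZl : forall (f : Cinf M) X Y,
    connection_fun (f *: X) Y = f *: connection_fun X Y ;
  connectionDr : forall X Y Y',
    connection_fun X (Y + Y') = connection_fun X Y + connection_fun X Y' ;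
  connection_leibniz : forall (f : Cinf M) X Y,
    connection_fun X (f *: Y) = Vact X f *: Y + f *: connection_fun X Y }.

Definition torsion (nabla : connection) (X Y : Vect) : Vect :=
  nabla X Y - nabla Y X - bracket X Y.

(* Symmetric (0,2)-tensor fields: symmetric bilinear forms on the tangent
   spaces, depending smoothly on the point. *)
Record symtensor := Symtensor {
  symtensor_at :> forall p : M, tangent p -> tangent p -> R ;
  symtensorC : forall p v w, @symtensor_at p v w = symtensor_at w v ;
  symtensorL : forall p w, scalar (@symtensor_at p ^~ w) ;
  symtensor_smooth : forall X Y : Vect,
    (fun p => symtensor_at (X p) (Y p)) \in smooth M }.

Definition symtensor_app (g : symtensor) (X Y : Vect) : Cinf M :=
  MkCinf (symtensor_smooth g X Y).

Definition in_ker (g : symtensor) (Y : Vect) : Prop :=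
  forall X, symtensor_app g Y X = 0.

(* Y (g (X, Z)) = (L_Y g) (X, Z) + g (L_Y X, Z) + g (X, L_Y Z), and L_Y is
   the bracket with Y on vector fields. *)
Definition lie_derivative (Y : Vect) (g : symtensor) (X Z : Vect) : Cinf M :=
  Vact Y (symtensor_app g X Z)
  - symtensor_app g (bracket Y X) Z - symtensor_app g X (bracket Y Z).

Definition stationary (g : symtensor) : Prop :=
  forall Y, in_ker g Y -> forall X Z, lie_derivative Y g X Z = 0.

End tangent_vectors.

Section carrollian.
Context {R : realType} {n : nat} (M : manifold R n.+1).

(* At every point, [g] is diag(1, ..., 1, 0) in a suitable basis; such a form
   exists in positive dimension only, whence [n.+1]. *)
Definition degenerate_metric (g : symtensor M) : Prop :=
  forall p : M, exists2 e : 'I_n.+1 -> tangent p, is_basis e &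
    forall i j, g p (e i) (e j) = ((i == j) && (i != ord_max))%:R.

Record weak_carrollian := WeakCarrollian {
  metric : symtensor M ;
  kappa : Vect M ;
  metric_degenerate : degenerate_metric metric ;
  kappa_neq0 : forall p, kappa p != 0 ;
  kappa_complete : complete_field kappa ;
  kappa_span : forall Y, in_ker metric Y <-> exists f : Cinf M, Y = f *: kappa }.

Definition carrollian_connection (C : weak_carrollian) (nabla : connection M) :
    Prop :=
  (forall X Y, in_ker (metric C) Y -> in_ker (metric C) (nabla X Y)) /\
  (forall X Y Z, Vact X (symtensor_app (metric C) Y Z) =
    symtensor_app (metric C) (nabla X Y) Z +
    symtensor_app (metric C) Y (nabla X Z)).

End carrollian.

(* Main.v *)
Require Import Defs.
From HB Require Import structures.
From mathcomp Require Import all_boot all_order all_algebra.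
From mathcomp Require Import all_classical all_reals all_analysis.
From mathcomp Require Import ring.
Set Implicit Arguments.
Unset Strict Implicit.
Unset Printing Implicit Defensive.
Import Order.TTheory GRing.Theory Num.Theory.
Import numFieldNormedType.Exports.
Local Open Scope classical_set_scope.
Local Open Scope ring_scope.

(* All conditions on a Carrollian connection are affine, so solutions near the
   points of M can be glued.  Locally one works with weights: for a smooth
   function w, not zero at p, one looks for a global operator D that satisfies
   the conditions multiplied by w (a connection of weight w has the Leibniz
   rule D_X (f Y) = w X(f) Y + f D_X Y).  No partition of unity in the usual
   sense is needed: a countable family of such pairs (w, D), whose w have no
   common zero, is made locally finite by multiplying with smooth functions.

   Near p there is a frame E_1, ..., E_n, kappa.  The connection for which it
   is flat makes kappa parallel; half the covariant derivative of g corrects it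
   to a metric one.  If g is stationary, the contorsion of such a connection is
   well defined, and subtracting it makes the torsion T take values in ker g;
   then subtracting T / 2 makes the torsion vanish. *)

(** * Smooth functions on R^n *)

Section flat.
Context {R : realType}.

(** The classical smooth function exp(-1/s), extended by 0 to s <= 0. The extra factor s^-k makes
    the family closed under differentiation, up to linear combinations. *)
Definition flat (k : nat) (s : R) : R :=
  if 0 < s then s^-1 ^+ k * expR (- s^-1) else 0.

Lemma flat_gt0 k s : 0 < s -> 0 < flat k s.
Proof.
by move=> s0; rewrite /flat s0 mulr_gt0 ?expR_gt0 ?exprn_gt0 ?invr_gt0.
Qed.

Lemma flat_le0 k s : s <= 0 -> flat k s = 0.
Proof. by move=> s0; rewrite /flat ltNge s0. Qed.

Lemma flat_ge0 k s : 0 <= flat k s.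
Proof. by have [/flat_le0->//|/flat_gt0/ltW] := leP s 0. Qed.

(** The exponential dominates its term of degree k + 2 at 1/s. The quadratic bound is what makes the
    derivative at 0 vanish. *)
Lemma flat_bound k s : flat k s <= k.+2`!%:R * s ^+ 2.
Proof.
have [s0|s0] := leP s 0; first by rewrite flat_le0// mulr_ge0// sqr_ge0.
rewrite /flat s0 expRN ler_pdivrMr ?expR_gt0//.
have fk : 0 < (k.+2)`!%:R :> R by rewrite ltr0n fact_gt0.
have s'0 : 0 <= s^-1 by rewrite invr_ge0 ltW.
have := expR_ge1Dxn k.+1 s'0.
move=> /(le_trans _) h.
have /h : s^-1 ^+ k.+2 / k.+2`!%:R <= 1 + s^-1 ^+ k.+2 / k.+2`!%:R.
  by rewrite lerDr ler01.
rewrite ler_pdivrMr// mulrC => h2.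
have : s ^+ 2 * s^-1 ^+ k.+2 <= s ^+ 2 * ((k.+2)`!%:R * expR s^-1).
  by rewrite ler_pM2l ?exprn_gt0.
have -> : s ^+ 2 * s^-1 ^+ k.+2 = s^-1 ^+ k.
  by rewrite !exprS expr0; field; rewrite gt_eqF.
by rewrite mulrA [s ^+ 2 * _]mulrC.
Qed.

Lemma is_derive_flat k (x : R) :
  is_derive x 1 (flat k) (flat k.+2 x - k%:R * flat k.+1 x).
Proof.
have [x0|x0|->] := ltgtP x 0.
- rewrite !flat_le0 ?ltW// mulr0 subr0.
  apply: (@near_eq_is_derive _ _ _ (cst 0)).
  by near=> y; rewrite flat_le0//; apply/ltW; near: y; exact: lt_nbhsl.
- apply: (@near_eq_is_derive _ _ _
    (((fun y : R => y^-1) ^+ k) * (expR \o (- (fun y : R => y^-1))))).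
    near=> y; rewrite /flat.
    have -> : 0 < y by near: y; exact: lt_nbhsr.
    by rewrite fctE; congr (_ * _); elim: k => // k IH; rewrite !exprS -IH.
  have dV : is_derive x 1 (fun y : R => y^-1) (- x ^- 2).
    have := @is_deriveV _ id x 1 1 (lt0r_neq0 x0) (is_derive_id x (1 : R)).
    by rewrite scaleNr [_ *: _]mulr1.
  apply: is_derive_eq.
  rewrite /flat x0 !fctE /=.
  rewrite /GRing.scale /= -exprVn.
  by case: k => [|k]; rewrite !exprS ?expr0 /=; ring.
- rewrite !flat_le0// mulr0 subr0.
  (* By [flat_bound] the difference quotient at 0 is at most (k+2)! |h| in absolute value. *)
  have h : h^-1 *: ((flat k \o shift 0) (h *: 1) - flat k 0) @[h --> 0^']
      --> (0 : R).
    apply/cvgrPdist_le => e e0.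
    near=> y.
    rewrite /= addr0 [y *: _]mulr1 (flat_le0 k (lexx 0)) subr0 sub0r.
    rewrite normrN normrZ normfV ler_pdivrMl ?normr_gt0; last first.
      by near: y; exact: nbhs_dnbhs_neq.
    rewrite ger0_norm ?flat_ge0// (le_trans (flat_bound k y))//.
    rewrite -real_normK ?num_real// expr2 mulrA [leRHS]mulrC ler_wpM2r//.
    rewrite mulrC -ler_pdivlMr ?ltr0n ?fact_gt0//.
    near: y.
    apply: dnbhs0_le; apply: divr_gt0 => //; rewrite ltr0n fact_gt0.
  by apply: DeriveDef; [exact: cvgP h|exact: cvg_lim h].
Unshelve. all: end_near. Qed.

End flat.

(** * Chain rules for maps into R and R^n *)

Section differentiable_rV.
Context {R : realType}.

Lemma derive_compR (V : normedModType R) (f : V -> R) (g : R -> R) x v a :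
  differentiable f x -> is_derive (f x) 1 g a ->
  differentiable (g \o f) x /\ 'D_v (g \o f) x = a * 'D_v f x.
Proof.
move=> fd [/derivable1_diffP gd <-].
have gfd := differentiable_comp fd gd.
split=> //.
by rewrite deriveE// diff_comp//= diff1E// derive1E mulrC -(deriveE v fd).
Qed.

Context {m n : nat}.

Lemma differentiable_rV (V : normedModType R) (phi : V -> 'rV[R]_n) x :
  (forall j, differentiable (fun y => phi y 0 j) x) -> differentiable phi x.
Proof.
move=> phid.
have -> : phi = \sum_(j < n) (fun y => phi y 0 j *: delta_mx 0 j).
  by apply/funext => y; rewrite fct_sumE -row_sum_delta.
by apply: differentiable_sum => j; exact: differentiableZl.
Qed.

Lemma derive_rV (V : normedModType R) (phi : V -> 'rV[R]_n) x v :
  differentiable phi x ->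
  'D_v phi x = \row_j 'D_v (fun y => phi y 0 j) x.
Proof.
move=> phid; rewrite derive_mx; last exact: diff_derivable.
by apply/matrixP => i j; rewrite !mxE ord1.
Qed.

Lemma derive_comp_rV (g : 'rV[R]_n -> R) (phi : 'rV[R]_m -> 'rV[R]_n) x v :
  (forall j, differentiable (fun y => phi y 0 j) x) ->
  differentiable g (phi x) ->
  'D_v (g \o phi) x =
  \sum_(j < n) 'D_('e_j) g (phi x) * 'D_v (fun y => phi y 0 j) x.
Proof.
move=> phid gd; have dphi := differentiable_rV phid.
rewrite deriveE; last exact: differentiable_comp.
rewrite diff_comp//= -(deriveE v dphi) derive_rV//.
rewrite [X in 'd g _ X]row_sum_delta linear_sum; apply: eq_bigr => j _.
by rewrite linearZ/= mxE [LHS]mulrC (deriveE _ gd).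
Qed.

Lemma derive_coord (x v : 'rV[R]_n) (j : 'I_n) :
  'D_v (fun y : 'rV[R]_n => y 0 j) x = v 0 j.
Proof.
have idd : differentiable (id : 'rV[R]_n -> 'rV[R]_n) x by [].
by have /rowP/(_ j) := derive_rV v idd; rewrite derive_id mxE.
Qed.

End differentiable_rV.

(** * Closure properties of the classes C^k *)

Section smooth_rV.
Context {R : realType} {n : nat}.
Implicit Types (U V : set 'rV[R]_n) (f g : 'rV[R]_n -> R).

Lemma Ck_local k U f :
  (forall x, U x -> exists V, [/\ open V, V x & Ck k V f]) -> Ck k U f.
Proof.
elim: k f => [|k IH] f fU /=.
  by move=> x /fU[V [_ Vx fc]]; exact: fc.
split=> [x /fU[V [_ Vx [fd _]]]|v]; first exact: fd.
apply: IH => x /fU[V [oV Vx [_ fD]]]; exists V; split=> //; exact: fD.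
Qed.

Lemma Ck_sub k U V f : V `<=` U -> Ck k U f -> Ck k V f.
Proof.
move=> VU; elim: k f => [|k IH] f /=; first by move=> fc x /VU; exact: fc.
by move=> [fd fD]; split=> [x /VU /fd//|v]; exact: IH.
Qed.

Lemma CkD k U f g : open U -> Ck k U f -> Ck k U g -> Ck k U (f + g).
Proof.
move=> oU fk gk; have -> : f + g = f - (0 - g) by rewrite sub0r opprK.
by apply: CkB => //; apply: CkB => //; exact: Ck_cst.
Qed.

Lemma Ck_sum k U (m : nat) (f : 'I_m -> 'rV[R]_n -> R) : open U ->
  (forall i, Ck k U (f i)) -> Ck k U (\sum_i f i).
Proof.
move=> oU fk; elim/big_rec: _ => [|i g _ gk]; first exact: Ck_cst.
exact: CkD.
Qed.

Lemma Ck_coord k U (j : 'I_n) : Ck k U (fun x => x 0 j).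
Proof.
case: k => [|k]; first by move=> x _; exact: coord_continuous.
split=> [x _|v]; first exact: differentiable_coord.
rewrite (_ : 'D_v _ = cst (v 0 j)); first exact: Ck_cst.
by apply/funext => x; rewrite derive_coord.
Qed.

(** The induction on [k] covers all [j] at once, since differentiating [flat j] brings in
    [flat j.+1] and [flat j.+2]. *)
Lemma Ck_flat k j U f : open U -> Ck k U f -> Ck k U (flat j \o f).
Proof.
move=> oU; elim: k j f => [|k IH] j f.
  move=> fc x Ux; apply: continuous_comp; first exact: fc.
  apply/differentiable_continuous/derivable1_diffP.
  by case: (is_derive_flat j (f x)).
move=> fk; have [fd fD] := fk; split=> [x Ux|v].
  by have [] := derive_compR 0 (fd x Ux) (is_derive_flat j (f x)).
have : Ck k U ((flat j.+2 \o f - cst j%:R * (flat j.+1 \o f)) * 'D_v f).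
  apply: CkM => //; last exact: fD.
  apply: CkB => //; first exact/IH/CkS.
  by apply: CkM => //; [exact: Ck_cst|exact/IH/CkS].
apply: Ck_ext => // x Ux.
by have [_ ->] := derive_compR v (fd x Ux) (is_derive_flat j (f x)).
Qed.

Lemma CkV k U f : open U -> (forall x, U x -> f x != 0) -> Ck k U f ->
  Ck k U (fun x => (f x)^-1).
Proof.
move=> oU f0; elim: k => [|k IH].
  by move=> fc x Ux; apply: continuousV; [exact: f0|exact: fc].
move=> fk; have [fd fD] := fk; split=> [x Ux|v].
  by apply: differentiableV; [exact: fd|exact: f0].
have fVk := IH (CkS fk).
have : Ck k U ((cst 0 - (fun x => (f x)^-1) * (fun x => (f x)^-1)) * 'D_v f).
  apply: CkM => //; last exact: fD.
  by apply: CkB => //; [exact: Ck_cst|exact: CkM].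
apply: Ck_ext => // x Ux.
rewrite deriveV; [|exact: f0|exact/diff_derivable/fd].
by rewrite !fctE /= sub0r -exprVn expr2.
Qed.

End smooth_rV.

(** By the chain rule, a derivative of [f \o phi] is a sum of products of ['D_('e_j) f \o phi] with
    derivatives of the coordinates of [phi]; the induction hypothesis applies to the first
    factors. *)
Lemma Ck_comp (R : realType) (m n k : nat) (U : set 'rV[R]_m)
    (V : set 'rV[R]_n) (f : 'rV[R]_n -> R) (phi : 'rV[R]_m -> 'rV[R]_n) :
  open U -> open V -> (forall x, U x -> V (phi x)) ->
  (forall j, Ck k U (fun x => phi x 0 j)) -> Ck k V f -> Ck k U (f \o phi).
Proof.
move=> oU oV UV; elim: k f => [|k IH] f.
  move=> phic fc x Ux; apply: continuous_comp; last exact/fc/UV.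
  have -> : phi = \sum_(j < n) (fun y => phi y 0 j *: delta_mx 0 j).
    by apply/funext => y; rewrite fct_sumE -row_sum_delta.
  elim/big_rec: _ => [|j h _ hc]; first exact: cst_continuous.
  apply: (@continuousD _ _ _ _ _ x _ hc).
  exact: (@cvgZr_tmp _ _ _ (nbhs x) _ (fun y => phi y 0 j) _
    (delta_mx 0 j : ('rV[R]_n : normedModType R)) (phic j x Ux)).
move=> phik [fd fD].
have phid j x : U x -> differentiable (fun x => phi x 0 j) x.
  by case: (phik j) => + _; apply.
split=> [x Ux|v].
  apply: differentiable_comp; last exact/fd/UV.
  by apply: differentiable_rV => j; exact: phid.
pose F (j : 'I_n) : 'rV[R]_m -> R :=
  ('D_('e_j) f \o phi) * 'D_v (fun y => phi y 0 j).
have : Ck k U (\sum_j F j).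
  apply: Ck_sum => // j.
  apply: CkM => //; last by case: (phik j) => _; apply.
  by apply: IH => [i|]; [exact/CkS/phik|exact: fD].
apply: Ck_ext => // x Ux.
by rewrite derive_comp_rV; [rewrite fct_sumE|move=> j; exact: phid|exact/fd/UV].
Qed.

(** * Charts and cut-off functions *)

Section cutoff.
Context {R : realType} {n : nat}.

(** The squared Euclidean distance [s] is polynomial, hence smooth, while [closed_ball] refers to
    the maximum norm. Outside the closed ball some coordinate differs from that of [a] by more than
    [r], so [r ^+ 2 - s] is negative there and [flat 0] sends it to 0. *)
Lemma exists_cutoff (U : set 'rV[R]_n) (a : 'rV[R]_n) : open U -> U a ->
  exists K (rho : 'rV[R]_n -> R), [/\ compact K, K `<=` U,
    forall k, Ck k setT rho, forall x, ~ K x -> rho x = 0 & rho a != 0].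
Proof.
move=> oU Ua.
have /nbhs_closedballP[e eU] : nbhs a U by exact: open_nbhs_nbhs.
set r := e%:num in eU; have r0 : 0 < r by rewrite /r.
pose t (j : 'I_n) : 'rV[R]_n -> R :=
  ((fun x => x 0 j) - cst (a 0 j)) * ((fun x => x 0 j) - cst (a 0 j)).
pose s := \sum_j t j.
have sE x : s x = \sum_j (x 0 j - a 0 j) ^+ 2 by rewrite /s fct_sumE.
exists (closed_ball a r), (flat 0 \o (cst (r ^+ 2) - s)); split => //.
- apply: bounded_closed_compact; last exact: closed_ball_closed.
  rewrite closed_ballE//; exists (`|a| + r); split; first exact: num_real.
  move=> M ltM x /= xr; apply/ltW/(le_lt_trans _ ltM).
  by rewrite -[x](subrK a) addrC (le_trans (ler_normD _ _))// lerD2l distrC.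
- move=> k; apply: Ck_flat; first exact: openT.
  apply: CkB; [exact: openT|exact: Ck_cst|apply: Ck_sum; first exact: openT].
  by move=> j; apply: CkM; [exact: openT|..];
    (apply: CkB; [exact: openT|exact: Ck_coord|exact: Ck_cst]).
- move=> x xr /=; rewrite flat_le0//.
  change (r ^+ 2 - s x <= 0); rewrite subr_le0 leNgt; apply/negP => sr.
  apply: xr; rewrite closed_ballE// /closed_ball_ /= distrC.
  rewrite [leLHS]mx_normrE; apply: bigmax_le => [|[i j] _]; first exact: ltW.
  suff : `|x 0 j - a 0 j| <= r by rewrite ord1 !mxE.
  rewrite -ler_sqr; [|by rewrite nnegrE|by rewrite nnegrE ltW].
  rewrite real_normK ?num_real//.
  rewrite (le_trans _ (ltW sr))// sE (bigD1 j)//= lerDl sumr_ge0// => l _.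
  exact: sqr_ge0.
- rewrite gt_eqF// flat_gt0//; change (0 < r ^+ 2 - s a).
  by rewrite sE big1 ?subr0 ?exprn_gt0// => j _; rewrite subrr expr0n.
Qed.

End cutoff.

Section charts.
Context {R : realType} {n : nat} (M : topologicalType) (c : chart R n M).

Lemma chart_preimage_open (O : set M) :
  open O -> open (chart_cod c `&` chart_inv c @^-1` O).
Proof.
move=> oO; rewrite openE => x [cx Ox].
have /= := @chart_inv_continuous _ _ _ c.
rewrite continuous_open_subspace; last exact: chart_cod_open.
move=> /(_ x (mem_set cx)) ctn; apply: filterI.
  by apply: open_nbhs_nbhs; split=> //; exact: chart_cod_open.
by apply: ctn; exact: open_nbhs_nbhs.
Qed.

Lemma chart_dom_map p : chart_dom c p -> chart_cod c (c p).
Proof. exact: chart_map_fun. Qed.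

Lemma chart_cod_inv x : chart_cod c x -> chart_dom c (chart_inv c x).
Proof. exact: chart_inv_fun. Qed.

Lemma chart_mapE p : chart_dom c p -> chart_inv c (c p) = p.
Proof. by move=> cp; rewrite chart_mapK ?inE. Qed.

Lemma chart_invE x : chart_cod c x -> c (chart_inv c x) = x.
Proof. by move=> cx; rewrite chart_invK ?inE. Qed.

Definition chart_ext (h : 'rV[R]_n -> R) (p : M) : R :=
  if `[< chart_dom c p >] then h (c p) else 0.

Lemma chart_ext_in h p : chart_dom c p -> chart_ext h p = h (c p).
Proof. by rewrite /chart_ext => cp; rewrite asboolT. Qed.

Lemma chart_ext_out h p : ~ chart_dom c p -> chart_ext h p = 0.
Proof. by rewrite /chart_ext => cp; rewrite asboolF. Qed.

End charts.

(** * Smooth functions on a manifold *)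

Section smooth_on_manifold.
Context {R : realType} {n : nat} (M : manifold R n).

Lemma smooth_near (f : M -> R) :
  (forall p, exists O g,
    [/\ open O, O p, g \in smooth M & forall q, O q -> f q = g q]) ->
  f \in smooth M.
Proof.
move=> fl; apply/asboolP => c cM k; apply: Ck_local => x cx.
have [W [g [oW Wx /asboolP gs fg]]] := fl (chart_inv c x).
exists (chart_cod c `&` chart_inv c @^-1` W); split=> //.
  exact: chart_preimage_open.
apply: (@Ck_ext _ _ _ _ (g \o chart_inv c)).
- exact: chart_preimage_open.
- by move=> y [_ /fg].
- by apply: Ck_sub (gs c cM k) => y [].
Qed.

Lemma smooth_flat j (f : M -> R) : f \in smooth M -> flat j \o f \in smooth M.
Proof.
move=> /asboolP fs; apply/asboolP => c cM k.
exact: Ck_flat (chart_cod_open c) (fs c cM k).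
Qed.

Lemma smooth_inv (f : M -> R) : (forall p, f p != 0) -> f \in smooth M ->
  (fun p => (f p)^-1) \in smooth M.
Proof.
move=> f0 /asboolP fs; apply/asboolP => c cM k.
by apply: CkV (chart_cod_open c) _ (fs c cM k) => x _; exact: f0.
Qed.

Lemma smooth_continuous (f : M -> R) : f \in smooth M -> continuous f.
Proof.
move=> /asboolP fs p; have [c cM cp] := atlas_cover p.
have := @chart_map_continuous _ _ _ c.
rewrite continuous_open_subspace; last exact: chart_dom_open.
move=> /(_ p (mem_set cp)) cc.
have fcp := fs c cM 0%N _ (chart_dom_map cp).
have : {for p, continuous ((f \o chart_inv c) \o c)} by exact: continuous_comp.
rewrite /prop_for /continuous_at /= chart_mapE//.
apply: cvg_trans; apply: near_eq_cvg.
have : nbhs p (chart_dom c).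
  by apply: open_nbhs_nbhs; split=> //; exact: chart_dom_open.
by apply: filterS => q cq /=; rewrite chart_mapE.
Qed.

Variable c : chart R n M.
Hypothesis cM : atlas M c.

(** The image of [K] in M is compact, hence closed because M is Hausdorff. So M is covered by two
    open sets: the chart domain, where the function is [h] after a change of charts, and the
    complement of the image of [K], where it is 0. *)
Lemma smooth_chart_ext (K : set 'rV[R]_n) h : compact K ->
  K `<=` chart_cod c -> smooth_on (chart_cod c) h ->
  (forall x, chart_cod c x -> ~ K x -> h x = 0) -> chart_ext c h \in smooth M.
Proof.
move=> cK Kc hs h0; apply/asboolP => c' c'M k; apply: Ck_local => x c'x.
have clK : closed (chart_inv c @` K).
  apply: compact_closed; first exact: manifold_hausdorff.
  apply: continuous_compact => //; apply: continuous_subspaceW Kc _.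
  exact: chart_inv_continuous.
have [cx|cx] := pselect (chart_dom c (chart_inv c' x)).
  exists (chart_cod c' `&` chart_inv c' @^-1` chart_dom c).
  have oV := @chart_preimage_open _ _ _ c' _ (chart_dom_open c).
  split=> //; apply: (@Ck_ext _ _ _ _ (h \o (c \o chart_inv c'))) => //.
    by move=> y [_ cy] /=; rewrite chart_ext_in.
  apply: Ck_comp (hs k) => //; first exact: chart_cod_open.
    by move=> y [_ cy]; exact: chart_dom_map.
  by move=> j; exact: atlas_compatible.
have oV := @chart_preimage_open _ _ _ c' _ (closed_openC clK).
exists (chart_cod c' `&` chart_inv c' @^-1` (~` (chart_inv c @` K))).
split=> //.
  by split=> // -[y Ky yx]; apply: cx; rewrite -yx; exact/chart_cod_inv/Kc.
apply: (@Ck_ext _ _ _ _ (cst 0)) => //; last exact: Ck_cst.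
move=> y [_ Ky] /=; have [cy|cy] := pselect (chart_dom c (chart_inv c' y)).
  rewrite chart_ext_in// h0//; first exact: chart_dom_map.
  move=> K'; apply: Ky; exists (c (chart_inv c' y)) => //.
  exact: chart_mapE.
by rewrite chart_ext_out.
Qed.

End smooth_on_manifold.

Section evaluation.
Context {R : realType} {n : nat} (M : manifold R n).
Implicit Types (f h : Cinf M) (X Y : Vect M).

Lemma Cinf_ext f h : (forall p, f p = h p) -> f = h.
Proof. by move=> fh; apply/val_inj/funext. Qed.

Lemma CinfD f h p : (f + h) p = f p + h p. Proof. by []. Qed.
Lemma CinfN f p : (- f) p = - f p. Proof. by []. Qed.
Lemma CinfM f h p : (f * h) p = f p * h p. Proof. by []. Qed.
Lemma CinfZ (a : R) f p : (a *: f) p = a * f p. Proof. by []. Qed.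
Lemma Cinf0 p : (0 : Cinf M) p = 0. Proof. by []. Qed.
Lemma Cinf1 p : (1 : Cinf M) p = 1. Proof. by []. Qed.

Lemma Cinf_sum (I : Type) (r : seq I) (P : pred I) (F : I -> Cinf M) p :
  (\sum_(i <- r | P i) F i) p = \sum_(i <- r | P i) F i p.
Proof. by elim/big_rec2: _ => [|i y x _ <-]. Qed.

Definition CinfE := (CinfD, CinfN, CinfM, CinfZ, Cinf0, Cinf1, Cinf_sum).

Lemma VectD X Y p : (X + Y) p = X p + Y p. Proof. by []. Qed.
Lemma VectN X p : (- X) p = - X p. Proof. by []. Qed.
Lemma VectZ h X p : (h *: X) p = h p *: X p. Proof. by []. Qed.
Lemma Vect0 p : (0 : Vect M) p = 0. Proof. by []. Qed.

Lemma Vect_sum (I : Type) (r : seq I) (P : pred I) (F : I -> Vect M) p :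
  (\sum_(i <- r | P i) F i) p = \sum_(i <- r | P i) F i p.
Proof. by elim/big_rec2: _ => [|i y x _ <-]. Qed.

Definition VectE := (VectD, VectN, VectZ, Vect0, Vect_sum).

Lemma tangent_ext p (u v : tangent p) : (forall f, u f = v f) -> u = v.
Proof. by move=> uv; apply/val_inj/funext. Qed.

Lemma tangent_sum p (I : Type) (r : seq I) (P : pred I) (F : I -> tangent p) f :
  (\sum_(i <- r | P i) F i) f = \sum_(i <- r | P i) F i f.
Proof. by elim/big_rec2: _ => [|i y x _ <-]. Qed.

Lemma tangentZ p (a : R) (v : tangent p) f : (a *: v) f = a * v f.
Proof. by []. Qed.

End evaluation.

(** * Coordinate vector fields, cut off to be global *)

Section chart_fields.
Context {R : realType} {n : nat} (M : manifold R n) (c : chart R n M).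
Hypothesis cM : atlas M c.
Variables (K : set 'rV[R]_n) (rho : 'rV[R]_n -> R).
Hypothesis cK : compact K.
Hypothesis Kc : K `<=` chart_cod c.
Hypothesis rho_smooth : forall k, Ck k setT rho.
Hypothesis rho0 : forall x, ~ K x -> rho x = 0.
Variable v : 'rV[R]_n.

Let chart_fun (f : Cinf M) := f \o chart_inv c.

Lemma chart_fun_smooth f k : Ck k (chart_cod c) (chart_fun f).
Proof. by have /asboolP := Cinf_smooth f; apply. Qed.

Lemma cutoff_smooth (h : 'rV[R]_n -> R) : smooth_on (chart_cod c) h ->
  chart_ext c (rho * h) \in smooth M.
Proof.
move=> hs; apply: (smooth_chart_ext cM cK Kc) => [k|x _ /rho0 rx].
  apply: CkM (hs k); first exact: chart_cod_open.
  exact: Ck_sub (rho_smooth k).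
by rewrite fctE rx mul0r.
Qed.

Definition chart_field_at (p : M) (f : Cinf M) : R :=
  chart_ext c (rho * 'D_v (chart_fun f)) p.

Lemma chart_field_derivation p : chart_field_at p \in derivation_at p.
Proof.
apply/asboolP; rewrite /chart_field_at.
have [cp|cp] := pselect (chart_dom c p); last first.
  by split=> [a f g|f g]; rewrite !chart_ext_out// ?mulr0 ?mul0r addr0.
have d f : derivable (chart_fun f) (c p) v.
  apply: diff_derivable; case: (chart_fun_smooth f 1) => + _; apply.
  exact: chart_dom_map.
split=> [a f g|f g]; rewrite !chart_ext_in// !fctE.
  have -> : chart_fun (a *: f + g) = a *: chart_fun f + chart_fun g by [].
  rewrite deriveD ?deriveZ//; last exact: derivableZ.
  by rewrite /GRing.scale /=; ring.
have -> : chart_fun (f * g) = chart_fun f * chart_fun g by [].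
rewrite deriveM// /chart_fun /= chart_mapE// /GRing.scale /=; ring.
Qed.

Lemma chart_field_smooth (f : Cinf M) :
  (fun p => Tangent (chart_field_derivation p) f) \in smooth M.
Proof.
by apply: cutoff_smooth => k; case: (chart_fun_smooth f k.+1) => _; apply.
Qed.

Definition chart_field : Vect M := MkVect chart_field_smooth.

(** The chart expression of [chart_ext c h] agrees with [h] on [chart_cod c], a neighbourhood of
    [c p], which suffices for a derivative. *)
Lemma chart_fieldE (p : M) (h : 'rV[R]_n -> R)
    (hs : chart_ext c h \in smooth M) : chart_dom c p ->
  chart_field p (MkCinf hs) = rho (c p) * 'D_v h (c p).
Proof.
move=> cp; rewrite /= /chart_field_at chart_ext_in// fctE; congr (_ * _).
apply: near_eq_derive.
have : nbhs (c p) (chart_cod c).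
  apply: open_nbhs_nbhs; split; [exact: chart_cod_open|exact: chart_dom_map].
apply: filterS => x cx; rewrite /chart_fun /= chart_ext_in ?chart_invE//.
exact: chart_cod_inv.
Qed.

End chart_fields.

Section spanning.
Context {R : realType} {n : nat} (M : manifold R n).

(* The n coordinate fields, cut off to be global, are independent at p; as
   T_p M is assumed n-dimensional, they span it. *)
Lemma vect_extension (p : M) (e : 'I_n -> tangent p) (v : tangent p) :
  is_basis e -> exists X : Vect M, X p = v.
Proof.
move=> eb; have [c cM cp] := atlas_cover p.
have [K [rho [cK Kc rs rho0 rhop]]] :=
  exists_cutoff (chart_cod_open c) (chart_dom_map cp).
pose B j := chart_field cM cK Kc rs rho0 'e_j.
(* The coordinates are centred at [c p], so that the derivative of [rho] drops out of the product
   rule for [rho * x k] at that point. *)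
pose x k : 'rV[R]_n -> R := (fun x => x 0 k) - cst (c p 0 k).
have xs k : smooth_on (chart_cod c) (x k).
  by move=> i; apply: CkB;
    [exact: chart_cod_open|exact: Ck_coord|exact: Ck_cst].
have ys k := cutoff_smooth cM cK Kc rs rho0 (xs k).
pose y k : Cinf M := MkCinf (ys k).
have By j k : B j p (y k) = rho (c p) ^+ 2 * (j == k)%:R.
  rewrite /B chart_fieldE// expr2 -mulrA; congr (_ * _).
  have dr : derivable rho (c p) 'e_j.
    by apply: diff_derivable; case: (rs 1%N) => + _; apply.
  have dx : derivable (fun x : 'rV[R]_n => x 0 k) (c p) 'e_j.
    exact/diff_derivable/differentiable_coord.
  rewrite deriveM//; last by apply: derivableB => //; exact: derivable_cst.
  rewrite deriveB// ?derive_coord ?derive_cst; last exact: derivable_cst.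
  have -> : x k (c p) = 0 by rewrite /x fctE subrr.
  by rewrite scale0r addr0 subr0 mxE /= eq_sym.
have [A AE] : exists A : 'M[R]_n, forall j, B j p = \sum_i A j i *: e i.
  have /choice[a aE] : forall j, exists a : 'rV_n, B j p = \sum_i a 0 i *: e i.
    by move=> j; have [a [aE _]] := eb (B j p); exists a.
  exists (\matrix_(j, i) a j 0 i) => j; rewrite aE.
  by under [RHS]eq_bigr do rewrite mxE.
(* [A] expands the fields in the basis [e], and testing on the [y k] shows that [Y] is a right
   inverse. Being square, [Y] is also a left inverse, so the coefficients [b *m Y] recover [v]. *)
pose Y : 'M[R]_n := \matrix_(i, k) (rho (c p) ^- 2 * e i (y k)).
have AY : A *m Y = 1%:M.
  apply/matrixP => j k; rewrite !mxE.
  under eq_bigr do rewrite mxE mulrCA.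
  rewrite -mulr_sumr -[RHS](mulKf (_ : rho (c p) ^+ 2 != 0)) ?expf_neq0//.
  congr (_ * _); rewrite -By AE tangent_sum.
  by apply: eq_bigr => i _; rewrite tangentZ.
have [b [vE _]] := eb v.
exists (\sum_j ((b *m Y) 0 j *: (1 : Cinf M)) *: B j).
rewrite Vect_sum vE.
under eq_bigr do rewrite VectZ CinfZ mulr1 AE scaler_sumr.
rewrite exchange_big; apply: eq_bigr => i _ /=.
under eq_bigr do rewrite scalerA.
rewrite -scaler_suml; congr (_ *: _).
have -> : \sum_j (b *m Y) 0 j * A j i = (b *m Y *m A) 0 i by rewrite [RHS]mxE.
by rewrite -mulmxA (mulmx1C AY) mulmx1.
Qed.

End spanning.

(** * Gluing *)

(** Compares two truncations of one sum: no nonzero term lies beyond the smaller bound. *)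
Lemma sum_ord_tail (V : nmodType) (F : nat -> V) (m k : nat) :
  (forall i, (m <= i)%N -> F i = 0) -> (forall i, (k <= i)%N -> F i = 0) ->
  \sum_(i < m) F i = \sum_(i < k) F i.
Proof.
wlog mk : m k / (m <= k)%N => [hw Fm Fk|Fm _].
  by case: (leqP m k) => [/hw|/ltnW /hw h]; [|rewrite h]; exact.
rewrite -!(big_mkord xpredT F) (big_cat_nat (leq0n m) mk)/=.
rewrite [X in _ + X]big1_seq ?addr0//.
by move=> i /andP[_]; rewrite mem_index_iota => /andP[/Fm].
Qed.

Section glueing.
Context {R : realType} {n : nat} (M : manifold R n).

Lemma Cinf_near_gt (f : Cinf M) p a : a < f p ->
  exists W : set M, [/\ open W, W p & forall q, W q -> a < f q].
Proof.
move=> ap; have fc := smooth_continuous (Cinf_smooth f).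
exists (f @^-1` [set x | a < x]); split=> //.
by apply: open_comp; [move=> x _; exact: fc|exact: open_gt].
Qed.

Context {T : Type} (Q : Cinf M -> (T -> Vect M) -> Prop).
Hypothesis Q0 : Q 0 (fun=> 0).
Hypothesis QD : forall h w D w' D', Q w D -> Q w' D' ->
  Q (h * w + w') (fun t => h *: D t + D' t).
Hypothesis Qloc : forall p : M, exists (w : Cinf M) D, w p != 0 /\ Q w D.

(** A Lindelof argument: each set of a countable base on which some solution has nowhere vanishing
    weight contributes one such solution, under the number of that set. By continuity of the
    weights, such sets cover M. *)
Lemma countable_solutions :
  exists (w : nat -> Cinf M) (D : nat -> T -> Vect M),
    (forall i, Q (w i) (D i)) /\ forall p, exists i, w i p != 0.
Proof.
have [B /countable_injP[f finj] [Bo Bb]] := manifold_second_countable M.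
pose good U (wD : Cinf M * (T -> Vect M)) :=
  Q wD.1 wD.2 /\ forall q, U q -> wD.1 q != 0.
have /choice[s sP] : forall i, exists wD : Cinf M * (T -> Vect M),
    Q wD.1 wD.2 /\ forall U, B U -> f U = i -> (exists wD', good U wD') ->
      forall q, U q -> wD.1 q != 0.
  move=> i; have [[U [BU fU [wD [QwD Uw]]]]|h] :=
    pselect (exists U, [/\ B U, f U = i & exists wD, good U wD]).
    exists wD; split=> // V BV fV _ q Vq; apply: Uw.
    by rewrite (finj U V) ?inE ?fU.
  (* A number that belongs to no such set receives the zero solution. *)
  exists (0, fun=> 0); split=> // U BU fU gU; exfalso; apply: h.
  by exists U.
exists (fun i => (s i).1), (fun i => (s i).2); split=> [i|p].
  by have [] := sP i.
have [w [D [wp QwD]]] := Qloc p.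
(* Squaring turns [w p != 0] into the strict inequality that [Cinf_near_gt] propagates. *)
have [|W [oW Wp Ww]] := @Cinf_near_gt (w * w) p 0.
  by rewrite CinfM -expr2 exprn_even_gt0.
have [U [BU Up] UW] : filter_from [set U | B U /\ U p] id W.
  by apply: Bb; exact: open_nbhs_nbhs.
exists (f U); have [_ /(_ U BU erefl)] := sP (f U); apply=> //.
exists (w, D); split=> //= q /UW/Ww; rewrite CinfM.
by apply: contraTneq => ->; rewrite mulr0 ltxx.
Qed.

(** [N t] is the sum of the [c i *: D i t] divided by the sum [S] of the [c i * w i], for suitable
    [c i]. These sums are finite near each point but perhaps not globally, whereas [QD] combines
    finitely many solutions. Hence the solution that agrees with [N] at [q], for all [t] at once,
    depends on [q]. *)
Lemma glue_local_solutions : exists N : T -> Vect M, forall q, exists w D,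
  [/\ Q w D, w q = 1 & forall t, N t q = D t q].
Proof.
have [w [D [QwD wn0]]] := countable_solutions.
pose b i := w i * w i.
pose th (i j : nat) : Cinf M :=
  MkCinf (smooth_flat 0 (Cinf_smooth (1 - i%:R *: b j))).
have thE i j q : th i j q = flat 0 (1 - i%:R * b j q) by [].
(* Since th i j q = 0 once i (w j q)^2 >= 1, the c i are locally finite, and
   c i does not vanish at q for the least i with w i q <> 0. *)
pose c i := (\prod_(j < i) th i j) * w i.
have cE i q : c i q = (\prod_(j < i) th i j q) * w i q.
  by rewrite CinfM; congr (_ * _); elim/big_rec2: _ => [|j y x _ <-].
have cfin p : exists k, exists W : set M, [/\ open W, W p &
    forall q, W q -> forall i, (k <= i)%N -> c i q = 0].
  have [j wj] := wn0 p.
  have bjp : 0 < b j p by rewrite CinfM -expr2 exprn_even_gt0.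
  have [W [oW Wp Wb]] : exists W : set M,
      [/\ open W, W p & forall q, W q -> b j p / 2 < b j q].
    by apply: Cinf_near_gt; rewrite ltr_pdivrMr// ltr_pMr// ltr1n.
  have := archi_boundP (_ : 0 <= (b j p / 2)^-1).
  set m := Num.bound _ => /(_ _)/ltW mP.
  (* The bound [j.+1] puts [th i j] among the factors of [c i], and [m] makes this factor vanish on
     [W], where [b j] exceeds [b j p / 2]. *)
  exists (maxn m j.+1), W; split=> // q Wq i; rewrite geq_max => /andP[mi ji].
  rewrite cE (bigD1 (Ordinal ji))// thE flat_le0; first by rewrite /= !mul0r.
  rewrite subr_le0 -ler_pdivrMr ?(lt_trans _ (Wb q Wq)) ?divr_gt0// mul1r.
  rewrite (@le_trans _ _ (b j p / 2)^-1)//.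
    by rewrite lef_pV2 ?posrE ?(lt_trans _ (Wb q Wq)) ?divr_gt0// ltW// Wb.
  by rewrite (le_trans (mP _))// ?ler_nat// invr_ge0 divr_ge0// ltW.
have [k kP] := choice cfin.
(* The bound [k q] may jump with [q]; near [p] it can be replaced by the fixed [k p], which gives
   the smoothness of the sums. *)
have kE (V : nmodType) (F : nat -> V) (p q : M) (W : set M) :
    (forall q, W q -> forall i, (k p <= i)%N -> c i q = 0) -> W q ->
    (forall i, c i q = 0 -> F i = 0) ->
    \sum_(i < k q) F i = \sum_(i < k p) F i.
  move=> Wc Wq F0; apply: sum_ord_tail => i ki; apply: F0; last exact: Wc ki.
  by have [W' [_ W'q]] := kP q; apply.
pose S q := \sum_(i < k q) (c i * w i) q.
have S_smooth : S \in smooth M.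
  apply: smooth_near => p; have [W [oW Wp Wc]] := kP p.
  exists W, (\sum_(i < k p) c i * w i); split=> // [|q Wq].
    exact: Cinf_smooth.
  rewrite /S Cinf_sum; apply: (kE _ (fun i => (c i * w i) q) p q W) => // i.
  by rewrite CinfM => ->; rewrite mul0r.
have S_neq0 q : S q != 0.
  have th_ge0 i : 0 <= \prod_(j < i) th i j q.
    by apply: prodr_ge0 => j _; rewrite thE flat_ge0.
  have cw_ge0 i : 0 <= (c i * w i) q.
    by rewrite CinfM cE -mulrA mulr_ge0// -expr2 sqr_ge0.
  case: (ex_minnP (wn0 q)) => i wi imin.
  have ciwi : 0 < c i q * w i q.
    rewrite cE -mulrA -expr2 mulr_gt0 ?exprn_even_gt0//.
    apply: prodr_gt0 => j _; rewrite thE flat_gt0// CinfM.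
    have /eqP -> : w j q == 0.
      by apply: contraTT (ltn_ord j) => /imin; rewrite -leqNgt.
    by rewrite !mulr0 subr0.
  have ik : (i < k q)%N.
    rewrite ltnNge; apply/negP => ki; have [W [_ Wq Wc]] := kP q.
    by move: ciwi; rewrite (Wc q Wq i ki) mul0r ltxx.
  apply/lt0r_neq0; rewrite /S (bigD1 (Ordinal ik))//.
  by apply: ltr_wpDr => //; apply: sumr_ge0 => j _; exact: cw_ge0.
pose S' : Cinf M := MkCinf (smooth_inv S_neq0 S_smooth).
have S'E q : S' q = (S q)^-1 by [].
have Dsum i : Q (\sum_(j < i) c j * w j) (fun t => \sum_(j < i) c j *: D j t).
  elim: i => [|i IH].
    by rewrite big_ord0 (_ : (fun t => _) = fun=> 0)//; apply/funext => t;
      rewrite big_ord0.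
  rewrite big_ord_recr/= addrC (_ : (fun t => _) =
    fun t => c i *: D i t + \sum_(j < i) c j *: D j t); first exact: QD.
  by apply/funext => t; rewrite big_ord_recr/= addrC.
pose V t q : tangent q := S' q *: \sum_(i < k q) c i q *: D i t q.
have V_smooth t (f : Cinf M) : (fun q => V t q f) \in smooth M.
  apply: smooth_near => p; have [W [oW Wp Wc]] := kP p.
  exists W, (S' * \sum_(i < k p) c i * Vact (D i t) f); split=> // [|q Wq].
    exact: Cinf_smooth.
  rewrite /V tangentZ tangent_sum CinfM Cinf_sum; congr (_ * _).
  apply: (kE _ (fun i => (c i q *: D i t q) f) p q W) => // i ci.
  by rewrite tangentZ ci mul0r.
exists (fun t => MkVect (V_smooth t)) => q.
(* Only the value at [q] matters, so a constant multiple of a finite sum serves. The [+ 0] below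
   fits scaling into the shape of [QD], with [Q0] as second solution. *)
pose a : Cinf M := S' q *: (1 : Cinf M).
exists (a * (\sum_(i < k q) c i * w i) + 0).
exists (fun t => a *: \sum_(i < k q) c i *: D i t + 0); split.
- exact: QD (Dsum _) Q0.
- by rewrite !CinfE mulr1 addr0 S'E mulVf.
- by move=> t; rewrite !VectE addr0 CinfZ mulr1.
Qed.

End glueing.

(** * Local frames *)

Section symtensors.
Context {R : realType} {n : nat} (M : manifold R n) (g : symtensor M).

Lemma symtensor_sumZl p (I : Type) (r : seq I) (a : I -> R)
    (v : I -> tangent p) (u : tangent p) :
  g p (\sum_(i <- r) a i *: v i) u = \sum_(i <- r) a i * g p (v i) u.
Proof.
elim: r => [|i r IH]; last by rewrite !big_cons symtensorL IH.
rewrite !big_nil -[0 in LHS](subrr 0) -scaleN1r addrC.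
by rewrite symtensorL mulN1r addNr.
Qed.

Lemma symtensor_sumZr p (I : Type) (r : seq I) (a : I -> R)
    (v : I -> tangent p) (u : tangent p) :
  g p u (\sum_(i <- r) a i *: v i) = \sum_(i <- r) a i * g p u (v i).
Proof.
by rewrite symtensorC symtensor_sumZl; under eq_bigr do rewrite symtensorC.
Qed.

Local Notation "<< X , Y >>" := (symtensor_app g X Y).

Lemma symtensor_appC X Y : <<X, Y>> = <<Y, X>>.
Proof. by apply: Cinf_ext => p; exact: symtensorC. Qed.

Lemma symtensor_appDl X Y Z : <<X + Y, Z>> = <<X, Z>> + <<Y, Z>>.
Proof.
apply: Cinf_ext => p; have := symtensorL g (Z p) 1 (X p) (Y p).
by rewrite scale1r mul1r.
Qed.

Lemma symtensor_app0l Z : <<0, Z>> = 0.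
Proof. by apply: (addrI <<0, Z>>); rewrite -symtensor_appDl !addr0. Qed.

Lemma symtensor_appZl h X Z : <<h *: X, Z>> = h * <<X, Z>>.
Proof.
apply: Cinf_ext => p; have := symtensorL g (Z p) (h p) (X p) 0.
by rewrite addr0 => /= ->; have /(congr1 (fun f : Cinf M => f p)) /= -> :=
  symtensor_app0l Z; rewrite addr0.
Qed.

Lemma symtensor_appNl X Z : <<- X, Z>> = - <<X, Z>>.
Proof. by rewrite -scaleN1r symtensor_appZl mulN1r. Qed.

Lemma symtensor_appDr X Y Z : <<Z, X + Y>> = <<Z, X>> + <<Z, Y>>.
Proof. by rewrite symtensor_appC symtensor_appDl !(symtensor_appC Z). Qed.

Lemma symtensor_appZr h X Z : <<Z, h *: X>> = h * <<Z, X>>.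
Proof. by rewrite symtensor_appC symtensor_appZl symtensor_appC. Qed.

Lemma symtensor_appNr X Z : <<Z, - X>> = - <<Z, X>>.
Proof. by rewrite symtensor_appC symtensor_appNl symtensor_appC. Qed.

Lemma symtensor_app_suml (I : Type) (r : seq I) (X : I -> Vect M) Z :
  <<\sum_(i <- r) X i, Z>> = \sum_(i <- r) <<X i, Z>>.
Proof.
elim: r => [|i r IH]; first by rewrite !big_nil symtensor_app0l.
by rewrite !big_cons symtensor_appDl IH.
Qed.

Definition symtensor_appE := (symtensor_appDl, symtensor_appDr, symtensor_appNl,
  symtensor_appNr, symtensor_appZl, symtensor_appZr).

End symtensors.

Section action.
Context {R : realType} {n : nat} (M : manifold R n).
Implicit Types (f h : Cinf M) (X Y : Vect M).

Lemma VactDl X Y f : Vact (X + Y) f = Vact X f + Vact Y f.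
Proof. exact: Cinf_ext. Qed.

Lemma VactZl h X f : Vact (h *: X) f = h * Vact X f.
Proof. exact: Cinf_ext. Qed.

Lemma VactD X f h : Vact X (f + h) = Vact X f + Vact X h.
Proof. by apply: Cinf_ext => p; exact: tangentD. Qed.

Lemma VactM X f h : Vact X (f * h) = f * Vact X h + Vact X f * h.
Proof. by apply: Cinf_ext => p; exact: tangentM. Qed.

(** Evaluation is made a ring morphism so that it commutes with determinants. *)
Definition Cinf_eval (p : M) (f : Cinf M) : R := f p.

Fact Cinf_eval_zmod p : zmod_morphism (Cinf_eval p). Proof. by []. Qed.
Fact Cinf_eval_monoid p : monoid_morphism (Cinf_eval p). Proof. by []. Qed.
HB.instance Definition _ p := GRing.isZmodMorphism.Build (Cinf M) R
  (Cinf_eval p) (Cinf_eval_zmod p).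
HB.instance Definition _ p := GRing.isMonoidMorphism.Build (Cinf M) R
  (Cinf_eval p) (Cinf_eval_monoid p).

End action.

Section frames.
Context {R : realType} {n : nat} (M : manifold R n.+1) (C : weak_carrollian M).
Local Notation g := (metric C).
Local Notation kappa := (kappa C).
Local Notation "<< X , Y >>" := (symtensor_app g X Y).

(** [phi] forgets the last coordinate in a diagonalising basis; on the others [g] is the standard
    inner product. *)
Lemma metric_coordinates q : exists phi : tangent q -> 'rV[R]_n,
  forall u v, g q u v = (phi u *m (phi v)^T) 0 0.
Proof.
have [e eb ge] := metric_degenerate C q.
have /choice[a aE] : forall v, exists a : 'rV[R]_n.+1, v = \sum_i a 0 i *: e i.
  by move=> v; have [a [aE _]] := eb v; exists a.
exists (fun v => \row_i a v 0 (widen_ord (leqnSn n) i)) => u v.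
rewrite {1}(aE u) {1}(aE v) symtensor_sumZl mxE.
under eq_bigr => i _.
  rewrite symtensor_sumZr (bigD1 i)//= big1 => [|j ji]; last first.
    by rewrite ge eq_sym (negPf ji) mulr0.
  rewrite ge eqxx addr0 /=; over.
rewrite big_ord_recr /= eqxx !mulr0 addr0; apply: eq_bigr => i _.
by rewrite !mxE neq_ltn /= ltn_ord mulr1.
Qed.

(** The Gram matrix factors as [A *m A^T], so a nonzero determinant makes [A] invertible.
    Orthogonality to all [E i] then forces [phi v = 0]. *)
Lemma metric_eq0 q (E : 'I_n -> tangent q) (v : tangent q) :
  \det (\matrix_(i, j) g q (E i) (E j)) != 0 ->
  (forall i, g q v (E i) = 0) -> forall u, g q v u = 0.
Proof.
have [phi gE] := metric_coordinates q; move=> detE vE u.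
pose A := \matrix_i phi (E i).
have GE : \matrix_(i, j) g q (E i) (E j) = A *m A^T.
  apply/matrixP => i j; rewrite !mxE gE !mxE.
  by apply: eq_bigr => k _; rewrite !mxE.
have AT : A^T \in unitmx.
  move: detE; rewrite GE det_mulmx mulf_eq0 negb_or => /andP[_ h].
  by rewrite unitmxE unitfE.
have phi0 : phi v *m A^T = 0.
  apply/rowP => i; rewrite [RHS]mxE -(vE i) gE !mxE.
  by apply: eq_bigr => k _; rewrite !mxE.
by rewrite gE -[phi v](mulmxK AT) phi0 !mul0mx mxE.
Qed.

Lemma symtensor_app_kerl Z : <<kappa, Z>> = 0.
Proof. by apply/(kappa_span C _).2; exists 1; rewrite scale1r. Qed.

Lemma symtensor_app_kerr Z : <<Z, kappa>> = 0.
Proof. by rewrite symtensor_appC symtensor_app_kerl. Qed.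

(* Multiplying by w clears the denominators of the expansion of Z in a local
   frame made of kappa and of n horizontal fields. *)
Lemma local_frame p : exists (w : Cinf M) (E F : 'I_n -> Vect M)
    (theta : Vect M -> Cinf M),
  [/\ w p != 0, forall h X Y, theta (h *: X + Y) = h * theta X + theta Y &
    forall Z, w *: Z = \sum_i <<Z, F i>> *: E i + theta Z *: kappa].
Proof.
have [e eb ge] := metric_degenerate C p.
have /choice[E EE] : forall i : 'I_n, exists X : Vect M,
  X p = e (widen_ord (leqnSn n) i) by move=> i; exact: vect_extension eb.
pose A : 'M[Cinf M]_n := \matrix_(i, j) <<E i, E j>>.
pose G := \det A.
have evA q : map_mx (Cinf_eval q) A = \matrix_(i, j) g q (E i q) (E j q).
  by apply/matrixP => i j; rewrite !mxE.
have evG q : G q = \det (\matrix_(i, j) g q (E i q) (E j q)).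
  by rewrite -evA det_map_mx.
have Gp : G p = 1.
  rewrite evG -[RHS](det1 _ n); congr (\det _); apply/matrixP => i j.
  by rewrite !mxE !EE ge neq_ltn /= ltn_ord andbT.
pose z Z : 'rV[Cinf M]_n := \row_j <<Z, E j>>.
(* Cramer's rule: up to the factor [G], this is [Z] minus its projection to the span of the
   [E i]. *)
pose W Z := G *: Z - \sum_i (z Z *m \adj A) 0 i *: E i.
have WE Z k : <<W Z, E k>> = 0.
  rewrite !symtensor_appE symtensor_app_suml.
  have : (z Z *m \adj A *m A) 0 k = (z Z *m G%:M) 0 k.
    by rewrite -mulmxA mul_adj_mx.
  rewrite mul_mx_scalar !mxE => <-; apply/eqP; rewrite subr_eq0; apply/eqP.
  by apply: eq_bigr => i _; rewrite symtensor_appZl !mxE.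
(* Where [G] vanishes, orthogonality to the [E i] says too little; the extra factor [G] puts the
   field in the kernel globally. *)
have GW Z : in_ker g (G *: W Z).
  move=> X; rewrite symtensor_appZl; apply: Cinf_ext => q; rewrite CinfM Cinf0.
  have [->|Gq] := eqVneq (G q) 0; first by rewrite mul0r.
  rewrite [symtensor_app _ _ _ _](metric_eq0 (E := fun i => E i q)) ?mulr0//.
    by rewrite -evG.
  by move=> i; have /(congr1 (fun f : Cinf M => f q)) := WE Z i.
(* [kappa_span] yields a coefficient of [kappa] without linearity in [Z]. Applying the fields to [f]
   gives an explicit linear formula for it, at the cost of a factor [s] that is nonzero at [p]. *)
have [f fp] : exists f, kappa p f != 0.
  apply: contrapT => h; have /eqP := kappa_neq0 C p; apply.
  apply: tangent_ext => f; apply: contrapT => /eqP fp; apply: h.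
  by exists f.
pose s := Vact kappa f.
have sGW Z : s *: (G *: W Z) = (G * Vact (W Z) f) *: kappa.
  have [h hE] := (kappa_span C _).1 (GW Z).
  by rewrite -VactZl hE VactZl scalerA [s * h]mulrC.
have WL h X Y : W (h *: X + Y) = h *: W X + W Y.
  have zL : z (h *: X + Y) = h *: z X + z Y.
    by apply/rowP => j; rewrite !mxE !symtensor_appE.
  rewrite /W zL mulmxDl -scalemxAl !scalerDr !scalerN scaler_sumr.
  rewrite !scalerA [G * h]mulrC addrACA -opprD -big_split /=.
  by congr (_ - _); apply: eq_bigr => i _; rewrite !mxE scalerDl scalerA.
(* The fields [E] become the [F] of the statement, and their adjugate combinations, dual to them up
   to a factor, become its [E]. *)
exists (s * G * G), (fun j => \sum_i (s * G * (\adj A) j i) *: E i), E,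
  (fun Z => G * Vact (W Z) f); split => [|h X Y|Z].
- by rewrite !CinfM Gp !mulr1.
- by rewrite WL VactDl VactZl mulrDr mulrCA.
- rewrite -sGW.
  have -> : \sum_j <<Z, E j>> *: (\sum_i (s * G * (\adj A) j i) *: E i) =
      (s * G) *: \sum_i (z Z *m \adj A) 0 i *: E i.
    under eq_bigr do rewrite scaler_sumr.
    rewrite exchange_big /= scaler_sumr; apply: eq_bigr => i _.
    under eq_bigr do rewrite scalerA.
    rewrite -scaler_suml scalerA mxE mulr_sumr; congr (_ *: _).
    by apply: eq_bigr => j _; rewrite [z _ _ _]mxE mulrCA.
  by rewrite scalerA -scalerDr addrC subrK !scalerA.
Qed.

End frames.

(** * Connections *)

Section bracket.
Context {R : realType} {n : nat} (M : manifold R n).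
Implicit Types (f h : Cinf M) (X Y Z : Vect M).

Lemma tangentDE p (u v : tangent p) (f : Cinf M) : (u + v) f = u f + v f.
Proof. by []. Qed.

Lemma tangentNE p (v : tangent p) (f : Cinf M) : (- v) f = - v f.
Proof. by []. Qed.

Lemma tangent0E p (f : Cinf M) : (0 : tangent p) f = 0.
Proof. by []. Qed.

Lemma bracketE X Y p f : bracket X Y p f = X p (Vact Y f) - Y p (Vact X f).
Proof. by []. Qed.

Definition tangentE :=
  (tangentDE, tangentNE, tangent0E, @tangentZ R n M, bracketE).

Lemma bracketC X Y : bracket X Y = - bracket Y X.
Proof.
apply: Vect_ext => p; apply: tangent_ext => f.
by rewrite VectE !tangentE opprB.
Qed.

Lemma bracketZDl h X X' Y :
  bracket (h *: X + X') Y = h *: bracket X Y + bracket X' Y - Vact Y h *: X.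
Proof.
apply: Vect_ext => p; apply: tangent_ext => f.
rewrite !VectE !tangentE VactDl VactZl !tangentD !tangentM /=.
ring.
Qed.

Lemma torsionC (nabla : connection M) X Y :
  torsion nabla X Y = - torsion nabla Y X.
Proof. by rewrite /torsion (bracketC X) opprK !opprB addrC. Qed.

Lemma connection_linear (nabla : connection M) h X X' Y :
  nabla (h *: X + X') Y = h *: nabla X Y + nabla X' Y.
Proof. by rewrite connectionDl connectionZl. Qed.

Lemma connection_leibnizD (nabla : connection M) h X Y Y' :
  nabla X (h *: Y + Y') = Vact X h *: Y + h *: nabla X Y + nabla X Y'.
Proof. by rewrite connectionDr connection_leibniz. Qed.

(** The terms [Vact Y h *: X] from the Leibniz rule and from the bracket cancel. *)
Lemma torsion_linearl (nabla : connection M) h X X' Y :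
  torsion nabla (h *: X + X') Y = h *: torsion nabla X Y + torsion nabla X' Y.
Proof.
rewrite /torsion connection_linear connection_leibnizD bracketZDl.
apply: Vect_ext => p; apply: tangent_ext => f.
rewrite !VectE !tangentE; ring.
Qed.

Lemma torsion_linearr (nabla : connection M) h X Y Y' :
  torsion nabla X (h *: Y + Y') = h *: torsion nabla X Y + torsion nabla X Y'.
Proof.
by rewrite torsionC torsion_linearl opprD -scalerN -!torsionC.
Qed.

End bracket.

Section linear_forms.
Context {R : realType} {n : nat} (M : manifold R n).

Definition linear_form (alpha : Vect M -> Cinf M) :=
  forall h X Y, alpha (h *: X + Y) = h * alpha X + alpha Y.

Variable alpha : Vect M -> Cinf M.
Hypothesis alphaL : linear_form alpha.

Lemma linear_form0 : alpha 0 = 0.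
Proof.
apply: (addrI (alpha 0)); have := alphaL 1 0 0.
by rewrite scale1r mul1r !addr0 => <-.
Qed.

Lemma linear_formZ h X : alpha (h *: X) = h * alpha X.
Proof. by have := alphaL h X 0; rewrite addr0 linear_form0 addr0. Qed.

Lemma linear_formD X Y : alpha (X + Y) = alpha X + alpha Y.
Proof. by have := alphaL 1 X Y; rewrite scale1r mul1r. Qed.

Lemma linear_form_sum (I : Type) (r : seq I) (X : I -> Vect M) :
  alpha (\sum_(i <- r) X i) = \sum_(i <- r) alpha (X i).
Proof.
elim: r => [|i r IH]; first by rewrite !big_nil linear_form0.
by rewrite !big_cons linear_formD IH.
Qed.

End linear_forms.

(** * Connections of weight [w] *)

Section weighted_connections.
Context {R : realType} {n : nat} (M : manifold R n.+1) (C : weak_carrollian M).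
Local Notation g := (metric C).
Local Notation kappa := (kappa C).
Local Notation "<< X , Y >>" := (symtensor_app g X Y).
Implicit Types (w h : Cinf M) (D : Vect M * Vect M -> Vect M) (X Y Z : Vect M).

(** [D] takes a pair because gluing handles families over a single index type. *)
Definition weighted_connection w D :=
  (forall h X X' Y, D (h *: X + X', Y) = h *: D (X, Y) + D (X', Y)) /\
  (forall h X Y Y', D (X, h *: Y + Y') =
     (w * Vact X h) *: Y + h *: D (X, Y) + D (X, Y')).

Definition weighted_carrollian w D := weighted_connection w D /\
  forall X Y Z, w * Vact X <<Y, Z>> = <<D (X, Y), Z>> + <<Y, D (X, Z)>>.

Lemma weighted_carrollian0 : weighted_carrollian 0 (fun=> 0).
Proof.
split; first split=> [h X X' Y|h X Y Y'].
- by rewrite scaler0 addr0.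
- by rewrite mul0r scale0r scaler0 !addr0.
- move=> X Y Z; rewrite mul0r symtensor_appC [<<Y, 0>>]symtensor_appC.
  by rewrite symtensor_appC !symtensor_app0l addr0.
Qed.

Lemma weighted_carrollianD h w D w' D' :
  weighted_carrollian w D -> weighted_carrollian w' D' ->
  weighted_carrollian (h * w + w') (fun t => h *: D t + D' t).
Proof.
move=> [[Dl Dr] Dg] [[D'l D'r] D'g]; split; first split=> [k X X' Y|k X Y Y'].
- rewrite Dl D'l; apply: Vect_ext => p; apply: tangent_ext => f.
  by rewrite !VectE !tangentE; ring.
- rewrite Dr D'r; apply: Vect_ext => p; apply: tangent_ext => f.
  by rewrite !VectE !tangentE !CinfE; ring.
- move=> X Y Z; rewrite mulrDl -mulrA Dg D'g !symtensor_appE.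
  by apply: Cinf_ext => p; rewrite !CinfE; ring.
Qed.

(** Each identity is checked at one point [q], with a solution whose weight is 1 there, so that the
    weighted rules become the ordinary ones. *)
Lemma connection_of_glued (N : Vect M * Vect M -> Vect M) :
  (forall q, exists w D, [/\ weighted_carrollian w D, w q = 1 &
     forall t, N t q = D t q]) ->
  exists nabla : connection M, carrollian_connection C nabla /\
    forall X Y, nabla X Y = N (X, Y).
Proof.
move=> NP.
have Nl h X X' Y : N (h *: X + X', Y) = h *: N (X, Y) + N (X', Y).
  apply: Vect_ext => q; have [w [D [[[Dl _] _] _ ND]]] := NP q.
  by rewrite !VectE !ND Dl.
have Nr h X Y Y' : N (X, h *: Y + Y') =
    Vact X h *: Y + h *: N (X, Y) + N (X, Y').
  apply: Vect_ext => q; have [w [D [[[_ Dr] _] wq ND]]] := NP q.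
  by rewrite !VectE !ND Dr !VectE CinfM wq mul1r.
have Ng X Y Z : Vact X <<Y, Z>> = <<N (X, Y), Z>> + <<Y, N (X, Z)>>.
  apply: Cinf_ext => q; have [w [D [[_ Dg] wq ND]]] := NP q.
  have := congr1 (fun f : Cinf M => f q) (Dg X Y Z).
  by rewrite !CinfE wq mul1r /= -!ND => ->.
have N0l Y : N (0, Y) = 0.
  apply: (addrI (N (0, Y))); have := Nl 1 0 0 Y.
  by rewrite !scale1r !addr0 => <-.
have N0r X : N (X, 0) = 0.
  have := Nr 1 X 0 0; rewrite !scale1r addr0 scaler0 add0r => h.
  by apply: (addrI (N (X, 0))); rewrite -h addr0.
have NDl X X' Y : N (X + X', Y) = N (X, Y) + N (X', Y).
  by have := Nl 1 X X' Y; rewrite !scale1r.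
have NZl h X Y : N (h *: X, Y) = h *: N (X, Y).
  by have := Nl h X 0 Y; rewrite addr0 N0l addr0.
have NL h X Y : N (X, h *: Y) = Vact X h *: Y + h *: N (X, Y).
  by have := Nr h X Y 0; rewrite addr0 N0r addr0.
have NDr X Y Y' : N (X, Y + Y') = N (X, Y) + N (X, Y').
  have := Nr 1 X Y Y'; rewrite !scale1r => ->.
  have -> : Vact X 1 = 0.
    by have := VactM X 1 1; rewrite !mulr1 mul1r -[LHS]addr0 => /addrI.
  by rewrite scale0r add0r.
exists (@Connection _ _ _ (fun X Y => N (X, Y)) NDl NZl NDr NL); split=> //.
(* For [Y] in the kernel, metricity reads X(0) = g(nabla_X Y, Z) + 0. *)
split=> [X Y kY Z|X Y Z] /=; last exact: Ng.
have := Ng X Y Z; rewrite !kY addr0 => <-.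
by have := VactM X 0 0; rewrite mul0r => ->; rewrite mul0r mulr0 addr0.
Qed.

End weighted_connections.

(** * Local solutions and existence theorems *)

Section existence.
Context {R : realType} {n : nat} (M : manifold R n.+1) (C : weak_carrollian M).
Local Notation g := (metric C).
Local Notation kappa := (kappa C).
Local Notation "<< X , Y >>" := (symtensor_app g X Y).
Implicit Types (w h : Cinf M) (D : Vect M * Vect M -> Vect M) (X Y Z : Vect M).

Let half : Cinf M := 2^-1 *: (1 : Cinf M).

Section local.
Variables (w : Cinf M) (E F : 'I_n -> Vect M) (theta : Vect M -> Cinf M).
Hypothesis thetaL : linear_form theta.
Hypothesis frame : forall Z,
  w *: Z = \sum_i <<Z, F i>> *: E i + theta Z *: kappa.

(** The musical isomorphism for forms that kill [kappa], up to the weight [w]; its values are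
    determined by the metric only modulo the kernel. *)
Definition sharp (alpha : Vect M -> Cinf M) := \sum_i alpha (E i) *: F i.

Lemma sharpP alpha Z : linear_form alpha -> alpha kappa = 0 ->
  <<sharp alpha, Z>> = w * alpha Z.
Proof.
move=> aL ak; rewrite -(linear_formZ aL) frame (linear_formD aL).
rewrite (linear_formZ aL) ak mulr0 addr0 (linear_form_sum aL).
rewrite symtensor_app_suml; apply: eq_bigr => i _.
by rewrite symtensor_appZl (linear_formZ aL) mulrC symtensor_appC.
Qed.

Lemma sharp_linear h alpha beta gamma :
  (forall Z, alpha Z = h * beta Z + gamma Z) ->
  sharp alpha = h *: sharp beta + sharp gamma.
Proof.
move=> aE; rewrite /sharp scaler_sumr -big_split; apply: eq_bigr => i _ /=.
by rewrite aE scalerDl scalerA.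
Qed.

(** In the expansion of [w *: kappa] the terms in [E i] vanish, and [kappa], nowhere zero, can be
    cancelled. *)
Lemma theta_kappa : theta kappa = w.
Proof.
have := frame kappa; rewrite big1 ?add0r => [wk|i _]; last first.
  by rewrite symtensor_app_kerl scale0r.
apply: Cinf_ext => p; have /eqP := congr1 (fun X : Vect M => X p) wk.
rewrite !VectE -subr_eq0 -scalerBl scaler_eq0 (negPf (kappa_neq0 C p)) orbF.
by rewrite subr_eq0 => /eqP.
Qed.

(* The flat connection of the local frame; it is not metric. *)
Definition frame_connection (t : Vect M * Vect M) : Vect M :=
  \sum_i Vact t.1 <<t.2, F i>> *: E i + Vact t.1 (theta t.2) *: kappa
  - Vact t.1 w *: t.2.

(** The frame expands [w *: Y], so differentiating the coefficients gives the flat derivative of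
    [w *: Y]; removing X(w) Y leaves [w] times that of [Y]. *)
Lemma frame_connectionP : weighted_connection w frame_connection.
Proof.
split=> [h X X' Y|h X Y Y']; rewrite /frame_connection /=.
  rewrite !VactDl !VactZl !scalerDr scaler_sumr.
  under eq_bigr do rewrite VactDl VactZl scalerDl -scalerA.
  rewrite big_split /=.
  apply: Vect_ext => p; apply: tangent_ext => f.
  by rewrite !VectE !tangentE !CinfE; ring.
rewrite thetaL VactD VactM.
under eq_bigr => i _.
  rewrite symtensor_appDl symtensor_appZl VactD VactM 2!scalerDl -!scalerA.
  over.
rewrite !big_split /= -!scaler_sumr.
have -> : \sum_i <<Y, F i>> *: E i = w *: Y - theta Y *: kappa.
  by rewrite frame addrK.
apply: Vect_ext => p; apply: tangent_ext => f.
by rewrite !VectE !tangentE !CinfE; ring.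
Qed.

Lemma frame_connection_kappa X : frame_connection (X, kappa) = 0.
Proof.
rewrite /frame_connection /= big1 => [|i _].
  by rewrite theta_kappa add0r subrr.
by rewrite symtensor_app_kerl -(mul0r 0) VactM mul0r mulr0 addr0 scale0r.
Qed.

(** One factor [w] comes from the frame connection, the other from [sharp]. The correction vanishes
    on [kappa], which therefore stays parallel. *)
Lemma parallel_connection : exists D,
  weighted_carrollian C (w * w) D /\ forall X, D (X, kappa) = 0.
Proof.
have [D0 [[D0l D0r] D0k]] : exists D0,
    weighted_connection w D0 /\ forall X, D0 (X, kappa) = 0.
  exists frame_connection; split; first exact: frame_connectionP.
  exact: frame_connection_kappa.
(* Half the covariant derivative of [g]. It is symmetric in [Y] and [Z], so the two corrections in
   the metricity equation add up to the whole defect. *)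
pose alpha X Y Z :=
  half * (w * Vact X <<Y, Z>> - <<D0 (X, Y), Z>> - <<Y, D0 (X, Z)>>).
have alphaL X Y : linear_form (alpha X Y).
  move=> h Z Z'; rewrite /alpha D0r !symtensor_appE VactD VactM.
  by apply: Cinf_ext => p; rewrite !CinfE; ring.
have alphak X Y : alpha X Y kappa = 0.
  rewrite /alpha D0k !symtensor_app_kerr symtensor_appC symtensor_app0l.
  by rewrite -(mul0r 0) VactM !(mul0r, mulr0, addr0, subr0).
exists (fun t => w *: D0 t + sharp (alpha t.1 t.2)); split; last first.
  move=> X; rewrite D0k scaler0 add0r /= /sharp big1 // => i _.
  rewrite /alpha D0k !symtensor_app_kerl symtensor_app0l.
  by rewrite -(mul0r 0) VactM !(mul0r, mulr0, addr0, subr0, scale0r).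
split; first split=> [h X X' Y|h X Y Y'] /=.
- rewrite (@sharp_linear h _ (alpha X Y) (alpha X' Y)) => [|Z].
    rewrite D0l; apply: Vect_ext => p; apply: tangent_ext => f.
    by rewrite !VectE !tangentE; ring.
  rewrite /alpha !D0l !symtensor_appE VactDl VactZl.
  by apply: Cinf_ext => p; rewrite !CinfE; ring.
- rewrite (@sharp_linear h _ (alpha X Y) (alpha X Y')) => [|Z].
    rewrite D0r; apply: Vect_ext => p; apply: tangent_ext => f.
    by rewrite !VectE !tangentE !CinfE; ring.
  rewrite /alpha !D0r !symtensor_appE VactD VactM.
  by apply: Cinf_ext => p; rewrite !CinfE; ring.
- move=> X Y Z /=; rewrite !symtensor_appE [<<Y, sharp _>>]symtensor_appC.
  rewrite !sharpP// /alpha.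
  rewrite [<<D0 (X, Z), Y>>]symtensor_appC [<<Z, D0 (X, Y)>>]symtensor_appC.
  rewrite [<<Z, Y>>]symtensor_appC.
  by apply: Cinf_ext => p; rewrite !CinfE; field.
Qed.

(* Subtracting the contorsion; it kills kappa exactly because g is
   stationary. *)
Lemma horizontal_torsion_free (nabla : connection M) :
  carrollian_connection C nabla -> stationary g -> exists D,
  weighted_carrollian C w D /\
  forall X Y Z, <<D (X, Y) - D (Y, X) - w *: bracket X Y, Z>> = 0.
Proof.
move=> [nk ng] gs.
pose tau X Y Z := <<torsion nabla X Y, Z>>.
have tauC X Y Z : tau X Y Z = - tau Y X Z.
  by rewrite /tau torsionC symtensor_appNl.
have tau1 h X X' Y Z : tau (h *: X + X') Y Z = h * tau X Y Z + tau X' Y Z.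
  by rewrite /tau torsion_linearl symtensor_appDl symtensor_appZl.
have tau2 h X Y Y' Z : tau X (h *: Y + Y') Z = h * tau X Y Z + tau X Y' Z.
  by rewrite /tau torsion_linearr symtensor_appDl symtensor_appZl.
have tau3 h X Y Z Z' : tau X Y (h *: Z + Z') = h * tau X Y Z + tau X Y Z'.
  by rewrite /tau symtensor_appDr symtensor_appZr.
(* It is antisymmetric in [Y] and [Z], which preserves metricity, and alternating it in [X] and [Y]
   gives [- tau X Y Z], which cancels the torsion. *)
pose alpha X Y Z := half * (tau X Z Y + tau Y Z X - tau X Y Z).
have alphaL X Y : linear_form (alpha X Y).
  move=> h Z Z'; rewrite /alpha !tau2 tau3.
  by apply: Cinf_ext => p; rewrite !CinfE; ring.
(* As [nabla X kappa] is in the kernel, metricity turns the left side into -1/2 times the Lie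
   derivative of [g] along [kappa]. *)
have alphak X Y : alpha X Y kappa = 0.
  have kk : in_ker g kappa by move=> Z; exact: symtensor_app_kerl.
  have := gs _ kk X Y; rewrite /lie_derivative ng => lie0.
  rewrite /alpha /tau symtensor_app_kerr subr0 /torsion !symtensor_appE.
  rewrite !(nk _ _ kk) !(bracketC _ kappa) !symtensor_appE.
  rewrite [<<nabla kappa Y, X>>]symtensor_appC.
  rewrite [<<bracket kappa Y, X>>]symtensor_appC.
  apply: Cinf_ext => p; have := congr1 (fun f : Cinf M => f p) lie0.
  rewrite !CinfE => lie0p.
  by rewrite -[RHS](mulr0 (- 2^-1)) -[in RHS]lie0p; ring.
exists (fun t => w *: nabla t.1 t.2 + sharp (alpha t.1 t.2)).
split; first split.
- split=> [h X X' Y|h X Y Y'] /=.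
    rewrite (@sharp_linear h _ (alpha X Y) (alpha X' Y)) => [|Z].
      rewrite connection_linear; apply: Vect_ext => p; apply: tangent_ext => f.
      by rewrite !VectE !tangentE; ring.
    rewrite /alpha !tau1 tau3.
    by apply: Cinf_ext => p; rewrite !CinfE; ring.
  rewrite (@sharp_linear h _ (alpha X Y) (alpha X Y')) => [|Z].
    rewrite connection_leibnizD; apply: Vect_ext => p; apply: tangent_ext => f.
    by rewrite !VectE !tangentE !CinfE; ring.
  rewrite /alpha tau3 tau1 tau2.
  by apply: Cinf_ext => p; rewrite !CinfE; ring.
- move=> X Y Z /=; rewrite !symtensor_appE [<<Y, sharp _>>]symtensor_appC.
  rewrite !sharpP// ng /alpha (tauC Z Y X).
  by apply: Cinf_ext => p; rewrite !CinfE; field.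
- move=> X Y Z /=; rewrite !symtensor_appE !sharpP// /alpha (tauC Y X Z).
  have -> : tau X Y Z =
      <<nabla X Y, Z>> - <<nabla Y X, Z>> - <<bracket X Y, Z>>.
    by rewrite /tau /torsion !symtensor_appE.
  by apply: Cinf_ext => p; rewrite !CinfE; field.
Qed.

End local.

Lemma exists_parallel_connection : exists nabla : connection M,
  carrollian_connection C nabla /\ forall X, nabla X kappa = 0.
Proof.
pose Q w D := weighted_carrollian C w D /\ forall X, D (X, kappa) = 0.
have [||p|N NQ] := @glue_local_solutions _ _ M _ Q.
- by split; first exact: weighted_carrollian0.
- move=> h w D w' D' [Dc Dk] [D'c D'k]; split.
    exact: weighted_carrollianD.
  by move=> X; rewrite Dk D'k scaler0 addr0.
- have [w [E [F [theta [wp thetaL frame]]]]] := local_frame C p.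
  have [D DQ] := parallel_connection thetaL frame.
  by exists (w * w), D; rewrite CinfM mulf_neq0.
have [|nabla [nc nE]] := @connection_of_glued _ _ _ C N.
  by move=> q; have [w [D [[Dc _] wq ND]]] := NQ q; exists w, D.
exists nabla; split=> // X; rewrite nE; apply: Vect_ext => q.
by have [w [D [[_ Dk] _ ->]]] := NQ q; rewrite Dk.
Qed.

Lemma exists_torsion_free_connection : stationary g ->
  exists nabla : connection M, carrollian_connection C nabla /\
    forall X Y, torsion nabla X Y = 0.
Proof.
move=> gs; have [nabla0 [nc0 _]] := exists_parallel_connection.
pose Q w D := weighted_carrollian C w D /\
  forall X Y Z, <<D (X, Y) - D (Y, X) - w *: bracket X Y, Z>> = 0.
have [||p|N NQ] := @glue_local_solutions _ _ M _ Q.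
- split; first exact: weighted_carrollian0.
  by move=> X Y Z; rewrite scale0r !subr0 symtensor_app0l.
- move=> h w D w' D' [Dc Dt] [D'c D't].
  split; first exact: weighted_carrollianD.
  move=> X Y Z.
  (* The weighted torsion is linear in the pair of [w] and [D]. *)
  transitivity (h * <<D (X, Y) - D (Y, X) - w *: bracket X Y, Z>>
    + <<D' (X, Y) - D' (Y, X) - w' *: bracket X Y, Z>>).
    by rewrite !symtensor_appE; apply: Cinf_ext => p; rewrite !CinfE; ring.
  by rewrite Dt D't mulr0 addr0.
- have [w [E [F [theta [wp thetaL frame]]]]] := local_frame C p.
  by have [D DQ] := horizontal_torsion_free frame nc0 gs; exists w, D.
have [|nabla [[nk ng] nE]] := @connection_of_glued _ _ _ C N.
  by move=> q; have [w [D [[Dc _] wq ND]]] := NQ q; exists w, D.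
have nt X Y Z : <<torsion nabla X Y, Z>> = 0.
  apply: Cinf_ext => q; have [w [D [[_ Dt] wq ND]]] := NQ q.
  rewrite -(Dt X Y Z) /torsion !nE !symtensor_appE !CinfE /= !ND wq; ring.
(* The torsion is antisymmetric, so subtracting half of it removes it entirely; being kernel-valued,
   it leaves the pairings with [g] unchanged. *)
pose T (t : Vect M * Vect M) :=
  nabla t.1 t.2 - half *: torsion nabla t.1 t.2.
have Tg X Y Z : <<T (X, Y), Z>> = <<nabla X Y, Z>>.
  by rewrite /T symtensor_appDl symtensor_appNl symtensor_appZl nt mulr0 subr0.
(* [T] is already a global solution of weight 1; the lemma only packages it as a connection. *)
have [|nabla' [nc' n'E]] := @connection_of_glued _ _ _ C T.
  move=> q; exists 1, T; split=> //; split; first split=> [h X X' Y|h X Y Y'].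
  - rewrite /T /= connection_linear torsion_linearl.
    apply: Vect_ext => p; apply: tangent_ext => f.
    by rewrite !VectE !tangentE; ring.
  - rewrite /T /= connection_leibnizD torsion_linearr.
    apply: Vect_ext => p; apply: tangent_ext => f.
    by rewrite !VectE !tangentE !CinfE; ring.
  - move=> X Y Z; rewrite mul1r ng Tg [<<Y, T _>>]symtensor_appC Tg.
    by rewrite [<<nabla X Z, Y>>]symtensor_appC.
exists nabla'; split=> // X Y.
rewrite {1}/torsion !n'E /T /= (torsionC nabla Y X) /torsion.
apply: Vect_ext => p; apply: tangent_ext => f.
by rewrite !VectE !tangentE !CinfE; field.
Qed.

(** Without torsion, [bracket Y X] is [nabla Y X] modulo the kernel, since [nabla X Y] lies in it.
    The Lie derivative of [g] along [Y] thus becomes its covariant derivative, which is 0. *)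
Lemma torsion_free_stationary (nabla : connection M) :
  carrollian_connection C nabla -> (forall X Y, torsion nabla X Y = 0) ->
  stationary g.
Proof.
move=> [nk ng] nt Y kY X Z.
have br W : bracket Y W = nabla Y W - nabla W Y.
  by apply/esym/eqP; rewrite -subr_eq0; apply/eqP/nt.
rewrite /lie_derivative ng !br !symtensor_appE (nk _ _ kY).
rewrite [<<X, nabla Z Y>>]symtensor_appC (nk _ _ kY).
by apply: Cinf_ext => p; rewrite !CinfE; ring.
Qed.

End existence.

Theorem corollary2p58 (R : realType) (n : nat) (M : manifold R n.+1)
    (C : weak_carrollian M) :
  (exists nabla : connection M, carrollian_connection C nabla) /\
  (exists nabla : connection M, carrollian_connection C nabla /\
     forall X : Vect M, nabla X (kappa C) = 0) /\
  ((exists nabla : connection M, carrollian_connection C nabla /\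
      forall X Y : Vect M, torsion nabla X Y = 0) <->
   stationary (metric C)).
Proof.
have [nabla [nc nk]] := exists_parallel_connection C.
split; first by exists nabla.
split; first by exists nabla.
split=> [[nabla' [nc' nt]]|]; last exact: exists_torsion_free_connection.
exact: torsion_free_stationary nc' nt.
Qed.
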